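(* Let $\nu^{(1)},\dots,\nu^{(\sigma)}$ be signatures, let $\zeta=\bigoplus_{l=1}^{\sigma}\rho_{\nu^{(l)}}$ be the corresponding polynomial representation of $\mathrm{GL}_n(\mathbb C)$ in $Z=\bigoplus_{l=1}^{\sigma}H_{\nu^{(l)}}$, and let $[\mathrm{GL}_n]_\zeta$ be the closure of the image of $\mathrm{GL}_n(\mathbb C)$ in $\mathbb P\mathrm{Mat}(Z)$ under $g\mapsto[\zeta(g)]$. Define the map $\pi_\zeta$ from the sea urchin $\mathfrak{SU}_n$ to $\mathbb P\mathrm{Mat}(Z)$ by $g\mapsto[\zeta(g)]$ for $g\in\mathrm{GL}_n(\mathbb C)$ and $(\mathbf m,\mathcal P)\mapsto\zeta(\mathbf m;\mathcal P)$ on the spikes. Then the image of $\mathfrak{SU}_n$ under $\pi_\zeta$ coincides with $[\mathrm{GL}_n]_\zeta$.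
   Context: Let $V=\mathbb C^n$ with standard basis $e_1,\dots,e_n$. For a complex vector space $Z$, $\mathbb P\mathrm{Mat}(Z)$ is the set of nonzero linear operators on $Z$ modulo nonzero scalars; $[A]$ denotes the class of $A$. A linear relation $P:V\rightrightarrows V$ is a linear subspace $P\subset V\oplus V$; operators are identified with their graphs $\{v\oplus Av\}$. Put $\mathrm{Ker}\,P=\{v: v\oplus 0\in P\}$, $\mathrm{Dom}\,P$ = projection of $P$ to the first summand, $\mathrm{Im}\,P$ = projection to the second summand, $\mathrm{Indef}\,P=\{w:0\oplus w\in P\}$, $\mathrm{rk}\,P=\dim\mathrm{Dom}\,P-\dim\mathrm{Ker}\,P$. For $c\in\mathbb C^*$, $c\cdot P=\{v\oplus cw: v\oplus w\in P\}$. If $\dim P=n$, there are bases $f_1,\dots,f_a,g_1,\dots,g_b,h_1,\dots,h_c$ and $F_1,\dots,F_a,G_1,\dots,G_b,H_1,\dots,H_c$ of $V$ such that $P$ is spanned by $0\oplus F_i$, $g_j\oplus G_j$, $h_k\oplus 0$; then $\lambda(P):\Lambda V\to\Lambda V$ is the operator sending $f_1\wedge\dots\wedge f_a\wedge g_{i_1}\wedge\dots\wedge g_{i_s}$ ($i_1<\dots<i_s$) to $F_1\wedge\dots\wedge F_a\wedge G_{i_1}\wedge\dots\wedge G_{i_s}$ and annihilating all other wedge monomials in the basis $f,g,h$; it is defined up to a nonzero scalar, and $\lambda^m(P)$ is its restriction $\Lambda^mV\to\Lambda^mV$. For $A\in\mathrm{GL}(V)$, $\lambda^m_{\mathrm{cha}}(A)v_1\wedge\dots\wedge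 v_m=Av_1\wedge\dots\wedge Av_m$. A hinge is a sequence $\mathcal P=(P_1,\dots,P_k)$ of $n$-dimensional linear relations $P_j\subset V\oplus V$ with $\mathrm{Ker}\,P_j=\mathrm{Dom}\,P_{j+1}$, $\mathrm{Im}\,P_j=\mathrm{Indef}\,P_{j+1}$ for $1\le j\le k-1$, $\mathrm{Dom}\,P_1=V$, $\mathrm{Im}\,P_k=V$, and $\mathrm{rk}\,P_j>0$ for all $j$. Then $P_1$ is the graph of an invertible operator $A$. Normalize $\lambda(P_1)=\lambda_{\mathrm{cha}}(A)$ and inductively normalize $\lambda(P_{j+1})$ so that $\lambda^{s_j}(P_{j+1})=\lambda^{s_j}(P_j)$, $s_j=\dim\mathrm{Im}\,P_j$ (these two are nonzero and proportional). $\mathcal L^m(\mathcal P)$ denotes the normalized $\lambda^m(P_j)$ for any $j$ with $\lambda^m(P_j)\neq0$ (well defined), and $\mathcal L(\mathcal P)=(\mathcal L^0(\mathcal P),\dots,\mathcal L^n(\mathcal P))$. For positive integers $\alpha_1,\dots,\alpha_\tau$ with sum $n$, $\mathcal O[\alpha]$ is the set of hinges with $\tau$ terms and $\mathrm{rk}\,P_j=\alpha_j$. Signature: integers $\nu_1\ge\dots\ge\nu_n\ge0$; put $\nu_{n+1}=0$, $\mathfrak H_\nu=\bigotimes_{j=1}^n(\Lambda^jV)^{\otimes(\nu_j-\nu_{j+1})}$, $\Xi_\nu=\bigotimes_j(e_1\wedge\dots\wedge e_j)^{\otimes(\nu_j-\nu_{j+1})}$. For $\mathcal A=(A_0,\dots,A_n)$,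 $A_j\in\mathrm{Mat}(\Lambda^jV)$, $\mathfrak r_\nu(\mathcal A)=\bigotimes_jA_j^{\otimes(\nu_j-\nu_{j+1})}$. $H_\nu$ is the span of $\mathfrak r_\nu(\lambda^\bullet_{\mathrm{cha}}(g))\Xi_\nu$, $g\in\mathrm{GL}_n(\mathbb C)$; $\rho_\nu(\mathcal A)$ is the restriction of $\mathfrak r_\nu(\mathcal A)$ to $H_\nu$ (which is invariant for the tuples considered), and $\rho_\nu(g)=\rho_\nu(\lambda^0_{\mathrm{cha}}(g),\dots,\lambda^n_{\mathrm{cha}}(g))$. Sea urchin: $\mathfrak{SU}_n$ is the disjoint union of $\mathrm{GL}_n(\mathbb C)$ and spikes $\mathfrak{sp}[\mathbf m]$, indexed by integer tuples $\mathbf m=(m_1\ge\dots\ge m_n)$ whose entries have no common divisor $>1$. Let $k_1>\dots>k_\tau$ be the distinct values of the $m_i$, and $\alpha_j$ the multiplicity of $k_j$. Points of $\mathfrak{sp}[\mathbf m]$ are hinges $\mathcal P\in\mathcal O[\alpha_1,\dots,\alpha_\tau]$ modulo $(P_1,\dots,P_\tau)\sim(c^{k_1}P_1,\dots,c^{k_\tau}P_\tau)$, $c\in\mathbb C^*$. Put $v^{(l)}=\sum_jm_j\nu^{(l)}_j$, $v=\max_lv^{(l)}$, and $\zeta(\mathbf m;\mathcal P)$ = class in $\mathbb P\mathrm{Mat}(Z)$ of $\bigoplus_lB_l$, where $B_l=\rho_{\nu^{(l)}}(\mathcal L(\mathcal P))$ if $v^{(l)}=v$ and $B_l=0$ otherwise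 (this class is well defined on the spike). *)

(* Defs.v *)
From HB Require Import structures.
From mathcomp Require Import all_boot all_order all_algebra.
From mathcomp Require Import reals complex.
Set Implicit Arguments. Unset Strict Implicit. Unset Printing Implicit Defensive.
Import Order.TTheory GRing.Theory Num.Theory.
Local Open Scope ring_scope.

Section Defs.
Variable R : realType.
Local Notation C := R[i].
Variable n : nat.

(* Exterior algebra  Lambda V, V = C^n, with its standard basis
   e_S = e_{s_1} /\ ... /\ e_{s_m}  (s_1 < ... < s_m),  S : {set 'I_n}.
   An operator on Lambda V is given by its matrix in this basis:
   A S T = coefficient of e_S in A e_T  (column convention).            *)
Definition lop := {set 'I_n} -> {set 'I_n} -> C.

Definition lopEq (A B : lop) := forall S T : {set 'I_n}, A S T = B S T.

Definition lop_mul (A B : lop) : lop :=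
  fun S T => \sum_(U : {set 'I_n}) A S U * B U T.

Definition minor (A : 'M[C]_n) (S T : {set 'I_n}) : C :=
  if #|S| == #|T| then
    \det (\matrix_(i < #|S|, j < #|S|)
             A (enum_val i) (nth (enum_val j) (enum T) j))
  else 0.

(* lambda_cha(A) : Lambda V -> Lambda V,  v_1/\../\v_m |-> Av_1/\../\Av_m *)
Definition lam_cha (A : 'M[C]_n) : lop := fun S T => minor A S T.

Definition lrestr (m : nat) (A : lop) : lop :=
  fun S T => if (#|S| == m) && (#|T| == m) then A S T else 0.

Definition lop_nz (A : lop) := exists S T : {set 'I_n}, A S T != 0.

(* Linear relations P : V => V, i.e. subspaces of V (+) V.  A vector
   v (+) w is encoded as the row vector  row_mx v^T w^T, and a subspace
   is the row space of a matrix  P : 'M_(n, n + n).                       *)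
Definition DomM (P : 'M[C]_(n, n + n)) := lsubmx P.
Definition ImM (P : 'M[C]_(n, n + n)) := rsubmx P.
Definition KerM (P : 'M[C]_(n, n + n)) := kermx (rsubmx P) *m lsubmx P.
Definition IndefM (P : 'M[C]_(n, n + n)) := kermx (lsubmx P) *m rsubmx P.
Definition rkRel (P : 'M[C]_(n, n + n)) : nat :=
  (\rank (DomM P) - \rank (KerM P))%N.

(* graph of an operator A : V -> V (column convention), {v (+) A v} *)
Definition graphM (A : 'M[C]_n) : 'M[C]_(n, n + n) := row_mx 1%:M A^T.

(* lambda(P): bases  f_1..f_a, g_1..g_b, h_1..h_c  (the columns of Bs) and
   F_1..F_a, G_1..G_b, H_1..H_c  (the columns of Bt) with P spanned by
   0(+)F_i, g_j(+)G_j, h_k(+)0;  lambda(P) sends f_1/\../\f_a/\g_I to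
   F_1/\../\F_a/\G_I and kills the other wedge monomials in f,g,h.       *)
Definition spanW (a b : nat) (Bs Bt : 'M[C]_n) : 'M[C]_(n, n + n) :=
  row_mx (diag_mx (\row_(k < n) ((a <= k)%N)%:R) *m Bs^T)
         (diag_mx (\row_(k < n) ((k < a + b)%N)%:R) *m Bt^T).

Definition Dab (a b : nat) : lop :=
  fun S T => if (S == T) && ([set i : 'I_n | (i < a)%N] \subset T)
                         && (T \subset [set i : 'I_n | (i < a + b)%N])
             then 1 else 0.

Definition isLambdaRep (P : 'M[C]_(n, n + n)) (L : lop) :=
  exists (a b : nat) (Bs Bt : 'M[C]_n),
    [/\ (a + b <= n)%N, Bs \in unitmx, Bt \in unitmx,
        (spanW a b Bs Bt == P)%MS &
        lopEq (lop_mul L (lam_cha Bs)) (lop_mul (lam_cha Bt) (Dab a b))].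

Definition isLambda (P : 'M[C]_(n, n + n)) (L : lop) :=
  exists (c : C) (L0 : lop), c != 0 /\ isLambdaRep P L0 /\
    lopEq L (fun S T => c * L0 S T).

(* Hinges  (P_1, ..., P_k)  encoded as  P 0, ..., P (k-1).              *)
Definition isHinge (k : nat) (P : nat -> 'M[C]_(n, n + n)) :=
  (0 < k)%N /\
  [/\ forall j, (j < k)%N -> \rank (P j) = n,
      forall j, (j.+1 < k)%N ->
        (KerM (P j) == DomM (P j.+1))%MS /\ (ImM (P j) == IndefM (P j.+1))%MS,
      \rank (DomM (P 0%N)) = n,
      \rank (ImM (P k.-1)) = n &
      forall j, (j < k)%N -> (0 < rkRel (P j))%N].

Definition normalizedLambdas (k : nat) (P : nat -> 'M[C]_(n, n + n))
    (L : nat -> lop) :=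
  [/\ forall j, (j < k)%N -> isLambda (P j) (L j),
      exists A : 'M[C]_n, (P 0%N == graphM A)%MS /\ lopEq (L 0%N) (lam_cha A) &
      forall j, (j.+1 < k)%N ->
        lopEq (lrestr (\rank (ImM (P j))) (L j.+1))
              (lrestr (\rank (ImM (P j))) (L j))].

(* Lc = L(P) = (L^0(P), ..., L^n(P)), as a degree preserving operator on
   Lambda V, with L^m(P) = normalized lambda^m(P_j) for a j where it is
   nonzero *)
Definition isLcal (k : nat) (L : nat -> lop) (Lc : lop) :=
  (forall S T : {set 'I_n}, #|S| != #|T| -> Lc S T = 0) /\
  forall m, (m <= n)%N -> exists j, [/\ (j < k)%N, lop_nz (lrestr m (L j)) &
      lopEq (lrestr m Lc) (lrestr m (L j))].

(* Signatures nu : 'I_n -> nat (nu i = nu_{i+1}), the space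
   H_nu c (x)_j (Lambda^j V)^{(x)(nu_j - nu_{j+1})}.  The tensor product
   has Nsig nu = nu_1 factors; the factor number i (i < nu_1) is
   Lambda^{dg nu i} V with dg nu i = #{ j | nu_j > i }, so exactly
   nu_j - nu_{j+1} factors are Lambda^j V.  It is embedded in
   (Lambda V)^{(x) nu_1}, with basis indexed by tuples of subsets.       *)
Definition isSignature (nu : 'I_n -> nat) :=
  forall i j : 'I_n, (i <= j)%N -> (nu j <= nu i)%N.

Definition Nsig (nu : 'I_n -> nat) : nat := \max_(i : 'I_n) nu i.
Definition dg (nu : 'I_n -> nat) (i : nat) : nat := #|[set j : 'I_n | (i < nu j)%N]|.

Definition tidx (nu : 'I_n -> nat) := {ffun 'I_(Nsig nu) -> {set 'I_n}}.
Definition tvec (nu : 'I_n -> nat) := tidx nu -> C.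

(* r_nu(A_0, ..., A_n) = (x)_j A_j^{(x)(nu_j - nu_{j+1})}, A = (+)_j A_j *)
Definition rT (nu : 'I_n -> nat) (A : lop) (x : tvec nu) : tvec nu :=
  fun S => \sum_(T : tidx nu) (\prod_(i < Nsig nu) A (S i) (T i)) * x T.

(* Xi_nu = (x)_j (e_1 /\ ... /\ e_j)^{(x)(nu_j - nu_{j+1})} *)
Definition Xi (nu : 'I_n -> nat) : tvec nu :=
  fun S => if [forall i, S i == [set j : 'I_n | (j < dg nu i)%N]] then 1 else 0.

Definition inH (nu : 'I_n -> nat) (x : tvec nu) :=
  exists (K : nat) (coef : 'I_K -> C) (gs : 'I_K -> 'M[C]_n),
    (forall k, gs k \in unitmx) /\
    forall S, x S = \sum_(k < K) coef k * rT (lam_cha (gs k)) (@Xi nu) S.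

(* Z = (+)_l H_{nu^(l)} inside (+)_l (Lambda V)^{(x) nu^(l)_1}.          *)
Variable sigma : nat.
Variable nus : 'I_sigma -> 'I_n -> nat.

Unset Implicit Arguments.
Definition Zvec := forall l : 'I_sigma, tvec (nus l).
Definition inZ (z : Zvec) := forall l, inH (z l).

(* operators on Z are represented by maps Zvec -> Zvec, only their
   restriction to Z matters. *)
Definition Zop := Zvec -> Zvec.

Definition zetaOp (A : lop) (keep : 'I_sigma -> bool) : Zop :=
  fun z l => if keep l then rT A (z l) else (fun _ => 0).

Definition zetaG (g : 'M[C]_n) : Zop := zetaOp (lam_cha g) (fun _ => true).

Definition projEqZ (X B : Zop) :=
  (exists z, inZ z /\ exists l S, B z l S != 0) /\
  exists c : C, c != 0 /\ forall z, inZ z -> forall l S, X z l S = c * B z l S.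

Definition isSpikeIndex (m : 'I_n -> int) :=
  (forall i j : 'I_n, (i <= j)%N -> m j <= m i) /\
  (\big[gcdn/0%N]_(i : 'I_n) `|m i|%N = 1%N).

Definition kvals (m : 'I_n -> int) : seq int :=
  sort (fun x y : int => y <= x) (undup [seq m i | i <- enum 'I_n]).
Definition tau (m : 'I_n -> int) : nat := size (kvals m).
Definition alpha (m : 'I_n -> int) (j : nat) : nat :=
  #|[set i : 'I_n | m i == nth 0 (kvals m) j]|.

Definition inO (m : 'I_n -> int) (P : nat -> 'M[C]_(n, n + n)) :=
  isHinge (tau m) P /\ forall j, (j < tau m)%N -> rkRel (P j) = alpha m j.

Definition vl (m : 'I_n -> int) (l : 'I_sigma) : int :=
  \sum_(i : 'I_n) m i * ((nus l i)%:Z).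

Definition isVmax (m : 'I_n -> int) (v : int) :=
  (exists l, vl m l = v) /\ forall l, vl m l <= v.

Definition zetaSpike (m : 'I_n -> int) (Lc : lop) (v : int) : Zop :=
  zetaOp Lc (fun l => vl m l == v).

Definition inImage (B : Zop) :=
  (exists g : 'M[C]_n, g \in unitmx /\ projEqZ (zetaG g) B) \/
  (exists (m : 'I_n -> int) (P : nat -> 'M[C]_(n, n + n)) (L : nat -> lop)
          (Lc : lop) (v : int),
     isSpikeIndex m /\ [/\ inO m P, normalizedLambdas (tau m) P L,
         isLcal (tau m) L Lc, isVmax m v & projEqZ (zetaSpike m Lc v) B]).

Definition cvgC (u : nat -> C) (a : C) :=
  forall eps : R, 0 < eps -> exists N, forall k, (N <= k)%N ->
    Normc.normc (u k - a) < eps.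

(* closure of {[zeta g]} in PMat(Z): [B] is a limit of classes [zeta g_k],
   i.e. suitable representatives c_k zeta(g_k) converge to B on Z *)



Definition inClosure (B : Zop) :=
  (exists z, inZ z /\ exists l S, B z l S != 0) /\
  exists (c : nat -> C) (g : nat -> 'M[C]_n),
    (forall k, g k \in unitmx) /\
    forall z : Zvec, inZ z -> forall (l : 'I_sigma) (S : tidx (nus l)), cvgC (fun k => c k * zetaG (g k) z l S) (B z l S).

End Defs.

(* Main.v *)
(** A degenerating family Y diag(t^m) X^-1 acts on Lambda^k V, after division by
the top power of t, in the limit as lambda(Y) E lambda(X^-1), where E projects on
the basis vectors e_S with sum_{i in S} m_i maximal.  A hinge in O[alpha] admits
common bases X, Y of all its relations, and L(P) is exactly this limit; so spike
points are limits of points of GL_n.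

Conversely, write the elements of a sequence in GL_n as U_k exp(x_k) V_k with U_k,
V_k in a fixed compact subset of GL_n and x_k a decreasing real vector, and pass to
limits along an ultrafilter.  The weights surviving in the limit are those of
bounded distance from the dominant one.  By Fourier-Motzkin elimination the same
set of weights is the top face for some integer vector m, and linear algebra gives a
real vector y with the right limit coefficients, so the limit is the image of
U exp(y) V if m = 0, and of a point of the spike of m otherwise. *)
Require Import Defs.
From HB Require Import structures.
From mathcomp Require Import boolp classical_sets filter topology normedtype sequences exp.
From mathcomp Require Import all_boot all_order all_algebra all_fingroup.
From mathcomp Require Import reals complex ring lra.
Set Implicit Arguments. Unset Strict Implicit. Unset Printing Implicit Defensive.
Import Order.TTheory GRing.Theory Num.Theory numFieldNormedType.Exports.
Local Open Scope ring_scope.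

(** * Minors *)

(** The sequence x_k may diverge at several rates at once, so it need not single out one direction.
    Only finitely many linear forms matter, however: the differences of weights, and the x_i - x_j
    that record the ordering. Being bounded below along the ultrafilter is the nonnegative cone of a
    total preorder on Q^n, and on finitely many vectors it agrees with the sign of one linear form,
    whose coefficients can be made integers. The scalars c_k in the definition of the closure are
    not controlled; cross-multiplying with one coordinate where the renormalized limit is nonzero
    eliminates them. The decomposition U exp(x) V comes from Gaussian elimination, whose outer
    factors and their inverses are bounded uniformly. On the hinge side the obstacle is that
    lambda(P) is given by a choice of bases and up to a scalar. Its entries are Pluecker coordinates
    of P up to a common factor, so a change of bases only changes the scalar; once all relations
    share bases, the normalization fixes every scalar. *)

Section CauchyBinet.
Variables (K : comNzRingType) (n : nat).

Definition enum_of (m : nat) (S : {set 'I_n}) (h : #|S| = m) (i : 'I_m) : 'I_n :=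
  enum_val (cast_ord (esym h) i).

Lemma enum_of_inj m (S : {set 'I_n}) (h : #|S| = m) : injective (enum_of h).
Proof. by move=> i j /enum_val_inj /cast_ord_inj. Qed.

Lemma enum_of_mem m (S : {set 'I_n}) (h : #|S| = m) i : enum_of h i \in S.
Proof. exact: enum_valP. Qed.

Lemma enum_of_surj m (S : {set 'I_n}) (h : #|S| = m) x :
  x \in S -> exists i, enum_of h i = x.
Proof.
move=> xS; exists (cast_ord h (enum_rank_in xS x)).
by rewrite /enum_of cast_ordK enum_rankK_in.
Qed.

(** Expanding each row sum chooses one middle index [f i] per row; only the injective [f] survive in
    the Cauchy-Binet sum. *)
Lemma det_mulmx_ffun m (A : 'M[K]_(m, n)) (B : 'M[K]_(n, m)) :
  \det (A *m B) =
  \sum_(f : {ffun 'I_m -> 'I_n}) (\prod_i A i (f i)) * \det (rowsub f B).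
Proof.
rewrite [LHS]/determinant.
under eq_bigr => s _.
  under eq_bigr => i _ do rewrite mxE.
  rewrite (bigA_distr_bigA (fun i j => A i j * B j (s i))) big_distrr /=.
  over.
rewrite exchange_big /=; apply: eq_bigr => f _.
rewrite [X in _ * X]/determinant big_distrr /=; apply: eq_bigr => s _.
rewrite big_split /= mulrCA; congr (_ * (_ * _)).
by apply: eq_bigr => i _; rewrite mxE.
Qed.

Lemma det_rowsub_perm m (f : 'I_m -> 'I_n) (s : {perm 'I_m}) (B : 'M[K]_(n, m)) :
  \det (rowsub (f \o s) B) = (-1) ^+ s * \det (rowsub f B).
Proof.
rewrite -det_perm -det_mulmx -row_permE; congr (\det _).
by apply/matrixP => i j; rewrite !mxE.
Qed.

(** Injective maps with image [S] are the increasing enumeration of [S] composed with the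
    permutations of ['I_m], so a sum over them can become a determinant. *)
Lemma sum_inj_image m (S : {set 'I_n}) (h : #|S| = m)
    (F : {ffun 'I_m -> 'I_n} -> K) :
  \sum_(f : {ffun 'I_m -> 'I_n} | injectiveb f && (f @: 'I_m == S)) F f =
  \sum_(s : {perm 'I_m}) F [ffun i => enum_of h (s i)].
Proof.
pose e (s : {perm 'I_m}) : {ffun 'I_m -> 'I_n} := [ffun i => enum_of h (s i)].
have e_inj : injective e.
  move=> s t est; apply/permP => i; apply: (@enum_of_inj _ _ h).
  by move/ffunP/(_ i): est; rewrite !ffunE.
transitivity (\sum_(f in e @: [set: {perm 'I_m}]) F f); last first.
  rewrite big_imset /=; last by move=> s t _ _; exact: e_inj.
  by apply: eq_bigl => s; rewrite inE.
apply: eq_bigl => f; apply/idP/imsetP; last first.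
    case=> s _ ->; apply/andP; split.
      by apply/injectiveP => i j; rewrite !ffunE => /enum_of_inj /perm_inj.
    apply/eqP/setP => x; apply/imsetP/idP.
      by case=> i _ ->; rewrite ffunE enum_of_mem.
    move=> /(enum_of_surj h) [i <-]; exists (s^-1%g i) => //.
    by rewrite ffunE permKV.
  case/andP => /injectiveP finj /eqP fS.
  have fm i : f i \in S by rewrite -fS imset_f.
  pose g i := cast_ord h (enum_rank_in (fm i) (f i)).
  have ge i : enum_of h (g i) = f i by rewrite /enum_of cast_ordK enum_rankK_in.
  have ginj : injective g by move=> i j eg; apply: finj; rewrite -!ge eg.
  exists (perm ginj) => //.
  by apply/ffunP => i; rewrite ffunE permE ge.
Qed.

(** The summand is an abstract [F] because the minors need a proof of [#|S| = m]; the hypotheses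
    describe [F] given such a proof and make it vanish elsewhere. *)
Lemma cauchy_binet m (A : 'M[K]_(m, n)) (B : 'M[K]_(n, m))
    (F : {set 'I_n} -> K) :
  (forall (S : {set 'I_n}) (h : #|S| = m),
     F S = \det (colsub (enum_of h) A) * \det (rowsub (enum_of h) B)) ->
  (forall S : {set 'I_n}, #|S| != m -> F S = 0) ->
  \det (A *m B) = \sum_S F S.
Proof.
move=> FE F0; rewrite det_mulmx_ffun.
rewrite (bigID (fun f : {ffun 'I_m -> 'I_n} => injectiveb f)) /= addrC big1 ?add0r.
  rewrite (partition_big (fun f : {ffun 'I_m -> 'I_n} => f @: 'I_m) predT) //=.
  apply: eq_bigr => S _; have [h|h] := eqVneq #|S| m; last first.
    rewrite F0 // big1 // => f /andP [/injectiveP finj /eqP fS].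
    by case/eqP: h; rewrite -fS card_imset // card_ord.
  rewrite (FE _ h) (sum_inj_image h) /= [\det (colsub _ _)]/determinant big_distrl /=.
  apply: eq_bigr => s _.
  have -> : rowsub [ffun i => enum_of h (s i)] B = rowsub (enum_of h \o s) B.
    by apply/matrixP => i j; rewrite !mxE ffunE.
  rewrite det_rowsub_perm mulrCA mulrA; congr (_ * _ * _).
  by apply: eq_bigr => i _; rewrite mxE ffunE.
move=> f /injectivePn [i [j ij fij]]; rewrite (determinant_alternate ij) ?mulr0 //.
by move=> k; rewrite !mxE fij.
Qed.

Lemma det_mxsub_bij k (p q : 'I_k -> 'I_n) (M : 'M[K]_n) :
  k = n -> injective p -> p =1 q -> \det (mxsub p q M) = \det M.
Proof.
move=> kn; subst k => pinj pq.
have -> : mxsub p q M = row_perm (perm pinj) (col_perm (perm pinj) M).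
  by apply/matrixP => i j; rewrite !mxE !permE !pq.
rewrite row_permE col_permE !det_mulmx !det_perm mulrCA odd_permV.
by rewrite -signr_addb addbb mulr1.
Qed.

(** Listing [T] first and its complement after it makes [M] block lower triangular with an identity
    block. The same reordering of rows and columns costs no sign. *)
Lemma det_mxsub_border (M : 'M[K]_n) (T : {set 'I_n}) m (h : #|T| = m) :
  (forall i t, t \notin T -> M i t = (i == t)%:R) ->
  \det M = \det (mxsub (enum_of h) (enum_of h) M).
Proof.
move=> MT.
have hC : #|~: T| = (n - m)%N by rewrite cardsCs setCK h card_ord.
pose p (i : 'I_(m + (n - m))) :=
  match split i with inl a => enum_of h a | inr b => enum_of hC b end.
have le_mn : (m <= n)%N by rewrite -h -[X in (_ <= X)%N]card_ord max_card.
have pl a : p (lshift _ a) = enum_of h a by rewrite /p (unsplitK (inl a)).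
have pr b : p (rshift _ b) = enum_of hC b by rewrite /p (unsplitK (inr b)).
have pTC b : enum_of hC b \notin T by have := enum_of_mem hC b; rewrite inE.
have pinj : injective p.
  move=> i j; rewrite -(splitK i) -(splitK j).
  case: (split i) => a; case: (split j) => b; rewrite /= ?pl ?pr.
  - by move/enum_of_inj ->.
  - by move=> E; have := pTC b; rewrite -E enum_of_mem.
  - by move=> E; have := pTC a; rewrite E enum_of_mem.
  - by move/enum_of_inj ->.
rewrite -(@det_mxsub_bij _ p p M (subnKC le_mn) pinj) //.
rewrite -(submxK (mxsub p p M)).
have -> : ursubmx (mxsub p p M) = 0.
  apply/matrixP => i j; rewrite !mxE pl pr MT //.
  case: eqP => // E; by have := pTC j; rewrite -E enum_of_mem.
have -> : drsubmx (mxsub p p M) = 1%:M.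
  by apply/matrixP => i j; rewrite !mxE !pr MT // (inj_eq (@enum_of_inj _ _ hC)).
rewrite det_lblock det1 mulr1; congr (\det _).
by apply/matrixP => i j; rewrite !mxE !pl.
Qed.

End CauchyBinet.

(** * The operators lambda(P) *)

Section Lop.
Variables (R : realType) (n : nat).
Local Notation C := R[i].
Local Notation lop := (lop R n).
Implicit Types (A B : 'M[C]_n) (L M N : lop) (S T U : {set 'I_n}).

Definition dlop (d : {set 'I_n} -> C) : lop := fun S T => if S == T then d S else 0.

Lemma lopEqP L M : lopEq L M <-> L = M.
Proof.
split=> [LM|-> //]; by apply/funext => S; apply/funext => T; exact: LM.
Qed.

Lemma lop_mulE L M S T : lop_mul L M S T = \sum_U L S U * M U T.
Proof. by []. Qed.

Lemma lop_mulA L M N : lop_mul L (lop_mul M N) = lop_mul (lop_mul L M) N.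
Proof.
apply/lopEqP => S T; rewrite /lop_mul.
under eq_bigr do rewrite big_distrr /=.
rewrite exchange_big /=; apply: eq_bigr => U _.
by rewrite big_distrl /=; apply: eq_bigr => V _; rewrite mulrA.
Qed.

Lemma dlop_mull d L S T : lop_mul (dlop d) L S T = d S * L S T.
Proof.
rewrite /lop_mul (bigD1 S) //= /dlop eqxx big1 ?addr0 // => U US.
by rewrite eq_sym (negbTE US) mul0r.
Qed.

Lemma dlop_mulr d L S T : lop_mul L (dlop d) S T = L S T * d T.
Proof.
rewrite /lop_mul (bigD1 T) //= /dlop eqxx big1 ?addr0 // => U UT.
by rewrite (negbTE UT) mulr0.
Qed.

Lemma lop_mul1l L : lop_mul (dlop (fun=> 1)) L = L.
Proof. by apply/lopEqP => S T; rewrite dlop_mull mul1r. Qed.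

Lemma lop_mul1r L : lop_mul L (dlop (fun=> 1)) = L.
Proof. by apply/lopEqP => S T; rewrite dlop_mulr mulr1. Qed.

Lemma DabE a b : Dab R a b = dlop (fun S =>
  (([set i : 'I_n | (i < a)%N] \subset S) && (S \subset [set i : 'I_n | (i < a + b)%N]))%:R).
Proof.
apply/lopEqP => S T; rewrite /Dab /dlop; case: eqP => //= ->.
by case: (_ && _).
Qed.

Lemma minorE A S T m (hS : #|S| = m) (hT : #|T| = m) :
  minor A S T = \det (mxsub (enum_of hS) (enum_of hT) A).
Proof.
subst m; rewrite /minor hT eqxx; congr (\det _).
apply/matrixP => i j; rewrite !mxE /enum_of; congr (A _ _).
  by rewrite cast_ord_id.
by rewrite [RHS](enum_val_nth (enum_val j)).
Qed.

Lemma minor_neq A S T : #|S| != #|T| -> minor A S T = 0.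
Proof. by rewrite /minor => /negbTE ->. Qed.

Lemma lam_chaM A B : lam_cha (A *m B) = lop_mul (lam_cha A) (lam_cha B).
Proof.
apply/lopEqP => S T; rewrite /lam_cha /lop_mul.
have [hT|h] := eqVneq #|T| #|S|; last first.
  rewrite minor_neq 1?eq_sym // big1 // => U _.
  have [hU|hU] := eqVneq #|S| #|U|; last by rewrite minor_neq ?mul0r.
  by rewrite [minor B U T]minor_neq ?mulr0 // -hU eq_sym.
rewrite (minorE _ (erefl #|S|) hT).
have -> : mxsub (enum_of (erefl #|S|)) (enum_of hT) (A *m B) =
    rowsub (enum_of (erefl #|S|)) A *m colsub (enum_of hT) B.
  by apply/matrixP => i j; rewrite !mxE; apply: eq_bigr => k _; rewrite !mxE.
apply: cauchy_binet => U hU; last by rewrite minor_neq ?mul0r // eq_sym.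
rewrite (minorE _ (erefl #|S|) hU) (minorE _ hU hT).
by congr (_ * _); congr (\det _); apply/matrixP => i j; rewrite !mxE.
Qed.

Lemma lam_cha_diag (d : 'rV[C]_n) :
  lam_cha (diag_mx d) = dlop (fun S => \prod_(i in S) d 0 i).
Proof.
apply/lopEqP => S T; rewrite /lam_cha /dlop.
have [->|ST] := eqVneq S T.
  rewrite (minorE _ (erefl #|T|) (erefl #|T|)).
  have -> : mxsub (enum_of (erefl #|T|)) (enum_of (erefl #|T|)) (diag_mx d) =
     diag_mx (\row_i d 0 (enum_val i)).
    apply/matrixP => i j; rewrite !mxE /enum_of !cast_ord_id.
    by rewrite (inj_eq enum_val_inj).
  rewrite det_diag [RHS]big_enum_val /=.
  by apply: eq_bigr => i _; rewrite mxE.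
have [hT|h] := eqVneq #|T| #|S|; last by rewrite minor_neq // eq_sym.
rewrite (minorE _ (erefl #|S|) hT).
(* For distinct sets of equal size, some index of [S] lies outside [T], and its row is zero. *)
have : ~~ (S \subset T).
  by apply: contra ST => sST; rewrite eqEcard sST hT leqnn.
case/subsetPn => s /(enum_of_surj (erefl #|S|)) [i0 <-] sT.
rewrite (expand_det_row _ i0) big1 // => j _; rewrite !mxE.
case: eqP => [E|_]; last by rewrite mulr0n mul0r.
by rewrite E enum_of_mem in sT.
Qed.

Lemma lam_cha1 : lam_cha (1%:M : 'M[C]_n) = dlop (fun=> 1).
Proof.
rewrite -diag_const_mx lam_cha_diag; apply/lopEqP => S T; rewrite /dlop.
by case: eqP => // _; apply: big1 => i _; rewrite mxE.
Qed.

Lemma lam_chaVl A : A \in unitmx -> lop_mul (lam_cha (invmx A)) (lam_cha A) = dlop (fun=> 1).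
Proof. by move=> Au; rewrite -lam_chaM mulVmx // lam_cha1. Qed.

Lemma lam_chaVr A : A \in unitmx -> lop_mul (lam_cha A) (lam_cha (invmx A)) = dlop (fun=> 1).
Proof. by move=> Au; rewrite -lam_chaM mulmxV // lam_cha1. Qed.

(* The columns of [1 | A^T] picked here give exactly the minor A S T, without
   the sign of the usual Pluecker coordinates. *)
Definition plucker_col S T (t : 'I_n) : 'I_(n + n) :=
  if t \in T then rshift n (nth t (enum S) (index t (enum T))) else lshift n t.

Definition plucker (P : 'M[C]_(n, n + n)) S T : C :=
  \det (colsub (plucker_col S T) P).

Lemma plucker_mulmx (W : 'M[C]_n) P S T :
  plucker (W *m P) S T = \det W * plucker P S T.
Proof.
rewrite /plucker -det_mulmx; congr (\det _).
by apply/matrixP => i j; rewrite !mxE; apply: eq_bigr => k _; rewrite !mxE.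
Qed.

(** The selected columns outside [T] are unit vectors, so only the [T] block contributes; it is a
    transposed submatrix because a graph stores [A^T]. *)
Lemma plucker_graph A S T : #|S| = #|T| ->
  plucker (graphM A) S T = lam_cha A S T.
Proof.
move=> hS; rewrite /plucker (@det_mxsub_border _ _ _ _ _ (erefl #|T|)); last first.
  by move=> i t tT; rewrite mxE /plucker_col (negbTE tT) row_mxEl mxE.
rewrite /lam_cha (minorE A hS (erefl _)) -det_tr; congr (\det _).
apply/matrixP => i j.
have e : plucker_col S T (enum_of (erefl #|T|) i) = rshift n (enum_of hS i).
  rewrite /plucker_col enum_of_mem; congr rshift.
  rewrite /enum_of cast_ord_id [RHS](enum_val_nth (enum_val i)) /=.
  congr (nth _ _ _); rewrite [X in index X _](enum_val_nth (enum_val i)).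
  by rewrite index_uniq ?enum_uniq // -cardE.
by rewrite [LHS]mxE [LHS]mxE [LHS]mxE e /graphM row_mxEr [LHS]mxE [RHS]mxE.
Qed.

Lemma poly_eq_nz (p q : {poly C}) : (forall t, t != 0 -> p.[t] = q.[t]) -> p = q.
Proof.
move=> pq; apply/eqP; rewrite -subr_eq0; apply/negPn/negP => r0.
pose rs := [seq (i.+1%:R : C) | i <- iota 0 (size (p - q))].
have r1 : all (root (p - q)) rs.
  apply/allP => _ /mapP [i _ ->]; rewrite rootE hornerD hornerN pq ?subrr //.
  by rewrite pnatr_eq0.
have r2 : uniq rs.
  rewrite map_inj_uniq ?iota_uniq // => i j /eqP.
  by rewrite eqr_nat => /eqP [].
by have := max_poly_roots r0 r1 r2; rewrite size_map size_iota ltnn.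
Qed.

Section Deform.
Variables (X Y : 'M[C]_n) (Xu : X \in unitmx).

(** With [d1] invertible the relation is, up to row operations, the graph of [Y diag(d2/d1) X^-1].
    The denominators cancel against the determinant of [diag_mx d1]. *)
Lemma plucker_diag_nz (d1 d2 : 'rV[C]_n) S T : #|S| = #|T| ->
  (forall i, d1 0 i != 0) ->
  plucker (row_mx (diag_mx d1 *m X^T) (diag_mx d2 *m Y^T)) S T =
  \det X * lop_mul (lam_cha Y) (lop_mul (dlop (fun U =>
     \prod_(i | i \notin U) d1 0 i * \prod_(i in U) d2 0 i)) (lam_cha (invmx X))) S T.
Proof.
move=> ST d1nz.
pose A := Y *m diag_mx (\row_i (d2 0 i / d1 0 i)) *m invmx X.
have -> : row_mx (diag_mx d1 *m X^T) (diag_mx d2 *m Y^T) =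
    (diag_mx d1 *m X^T) *m graphM A.
  rewrite /graphM mul_mx_row mulmx1; congr row_mx.
  rewrite /A !trmx_mul tr_diag_mx trmx_inv !mulmxA -[_ *m X^T *m _]mulmxA.
  rewrite mulmxV ?unitmx_tr // mulmx1 mulmx_diag; congr (diag_mx _ *m _).
  by apply/rowP => i; rewrite !mxE mulrCA divff ?mulr1.
rewrite plucker_mulmx plucker_graph // /A !lam_chaM lam_cha_diag -lop_mulA.
rewrite det_mulmx det_tr det_diag [\prod_ _ _ * _]mulrC -mulrA; congr (_ * _).
rewrite !lop_mulE big_distrr /=; apply: eq_bigr => U _.
rewrite !dlop_mull mulrCA; congr (_ * _); rewrite mulrA; congr (_ * _).
rewrite (bigID (mem U)) /= mulrAC [RHS]mulrC; congr (_ * _).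
rewrite -big_split /=; apply: eq_bigr => i _.
by rewrite mxE mulrCA divff ?mulr1.
Qed.

(** The 0/1 matrices in [spanW] may be singular, so their zeros are replaced by an indeterminate.
    Both sides become polynomials that agree at nonzero values, hence also at 0. *)
Lemma plucker_spanW a b S T : #|S| = #|T| ->
  plucker (spanW a b X Y) S T =
  \det X * lop_mul (lam_cha Y) (lop_mul (Dab R a b) (lam_cha (invmx X))) S T.
Proof.
move=> ST.
pose d1 : 'rV[{poly C}]_n := \row_k (if (k < a)%N then 'X else 1).
pose d2 : 'rV[{poly C}]_n := \row_k (if (k < a + b)%N then 1 else 'X).
pose cM (Z : 'M[C]_n) := map_mx polyC Z.
pose p : {poly C} := \det (colsub (plucker_col S T)
   (row_mx (diag_mx d1 *m (cM X)^T) (diag_mx d2 *m (cM Y)^T))).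
pose q : {poly C} := \sum_U (\det X * lam_cha Y S U * lam_cha (invmx X) U T)%:P *
   (\prod_(i | i \notin U) d1 0 i * \prod_(i in U) d2 0 i).
have pE t : p.[t] = plucker (row_mx (diag_mx (map_mx (horner_eval t) d1) *m X^T)
                              (diag_mx (map_mx (horner_eval t) d2) *m Y^T)) S T.
  rewrite -[p.[t]]/(horner_eval t p) /p -det_map_mx; congr (\det _).
  rewrite map_mxsub map_row_mx !map_mxM !map_diag_mx -!map_trmx -!map_mx_comp.
  have e Z : map_mx (horner_eval t \o polyC) Z = Z :> 'M_n.
    by apply/matrixP => i j; rewrite mxE /= /horner_eval hornerC.
  by rewrite !e.
have qE t : q.[t] = \det X * lop_mul (lam_cha Y) (lop_mul (dlop (fun U =>
     \prod_(i | i \notin U) (map_mx (horner_eval t) d1) 0 i *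
     \prod_(i in U) (map_mx (horner_eval t) d2) 0 i)) (lam_cha (invmx X))) S T.
  rewrite /q horner_sum lop_mulE mulr_sumr; apply: eq_bigr => U _.
  have e (Q : pred 'I_n) (d : 'rV[{poly C}]_n) :
      \prod_(i | Q i) (map_mx (horner_eval t) d) 0 i = (\prod_(i | Q i) d 0 i).[t].
    by rewrite horner_prod; apply: eq_bigr => i _; rewrite mxE.
  rewrite dlop_mull !e !hornerM hornerC -!mulrA; congr (_ * (_ * _)).
  by rewrite mulrC mulrA.
have pq : p = q.
  apply: poly_eq_nz => t t0; rewrite pE qE plucker_diag_nz // => i.
  by rewrite !mxE /horner_eval; case: ifP; rewrite !hornerE ?oner_eq0.
have d1E : map_mx (horner_eval 0) d1 = \row_(k < n) ((a <= k)%N)%:R.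
  apply/rowP => i; rewrite !mxE /horner_eval.
  by case: (ltnP i a); rewrite !hornerE.
have d2E : map_mx (horner_eval 0) d2 = \row_(k < n) ((k < a + b)%N)%:R.
  apply/rowP => i; rewrite !mxE /horner_eval.
  by case: (ltnP i (a + b)); rewrite !hornerE.
have := pE 0; rewrite pq qE d1E d2E -/(spanW a b X Y) => <-.
rewrite !lop_mulE; congr (_ * _); apply: eq_bigr => U _.
rewrite DabE !dlop_mull; congr (_ * (_ * _)).
(* At 0 the product is 1 if [U] lies between the two initial segments; otherwise a missing index
   below [a], or an extra one from [a + b] on, gives a zero factor. *)
case: andP => [[/subsetP aU /subsetP Ub]|nU].
  rewrite !big1 ?mulr1 // => i iU; rewrite mxE.
    by have := Ub _ iU; rewrite inE => ->.
  have -> // : (a <= i)%N.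
  by rewrite leqNgt; apply: contra iU => ia; rewrite aU // inE.
have [aU|naU] := boolP ([set i : 'I_n | (i < a)%N] \subset U).
  have /subsetPn [i iU] : ~~ (U \subset [set i : 'I_n | (i < a + b)%N]).
    by apply/negP => Ub; apply: nU.
  rewrite inE => /negbTE ib.
  by rewrite mulrC (bigD1 i) //= mxE ib !mul0r.
case/subsetPn: naU => i; rewrite inE => ia iU.
by rewrite (bigD1 i) //= mxE leqNgt ia !mul0r.
Qed.

End Deform.

(** For invertible [X], the solution [L] of the equation that defines [isLambdaRep]. *)
Definition lamXY a b (X Y : 'M[C]_n) : lop :=
  lop_mul (lam_cha Y) (lop_mul (Dab R a b) (lam_cha (invmx X))).

Lemma lam_neq A S T : #|S| != #|T| -> lam_cha A S T = 0.
Proof. exact: minor_neq. Qed.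

Lemma lop_mul_deg L M :
  (forall S T, #|S| != #|T| -> L S T = 0) -> (forall S T, #|S| != #|T| -> M S T = 0) ->
  forall S T, #|S| != #|T| -> lop_mul L M S T = 0.
Proof.
move=> L0 M0 S T ST; apply: big1 => U _.
have [SU|SU] := eqVneq #|S| #|U|; last by rewrite L0 ?mul0r.
by rewrite M0 ?mulr0 // -SU.
Qed.

Lemma dlop_deg d S T : #|S| != #|T| -> dlop d S T = 0.
Proof. by move=> ST; rewrite /dlop; case: (S =P T) => // E; rewrite E eqxx in ST. Qed.

Lemma lamXY_deg a b X Y S T : #|S| != #|T| -> lamXY a b X Y S T = 0.
Proof.
move: S T; apply: lop_mul_deg; first exact: lam_neq.
by apply: lop_mul_deg; [rewrite DabE; exact: dlop_deg | exact: lam_neq].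
Qed.

Lemma isLambdaRep_lamXY P L : isLambdaRep P L ->
  exists a b X Y, [/\ (a + b <= n)%N, X \in unitmx, Y \in unitmx,
    (spanW a b X Y == P)%MS & L = lamXY a b X Y].
Proof.
case=> a [b [X [Y [ab Xu Yu sP /lopEqP E]]]]; exists a, b, X, Y; split=> //.
by rewrite /lamXY lop_mulA -E -lop_mulA lam_chaVr // lop_mul1r.
Qed.

Lemma lamXY_isLambdaRep a b X Y P : (a + b <= n)%N -> X \in unitmx -> Y \in unitmx ->
  (spanW a b X Y == P)%MS -> isLambdaRep P (lamXY a b X Y).
Proof.
move=> ab Xu Yu sP; exists a, b, X, Y; split=> //; apply/lopEqP.
by rewrite /lamXY -!lop_mulA lam_chaVl // lop_mul1r.
Qed.

(* lambda(P) is determined up to a scalar since its entries are, up to the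
   scalar det X, the Pluecker coordinates of P. *)
Lemma isLambda_uniq P L a b X Y : \rank P = n -> X \in unitmx -> Y \in unitmx ->
  (spanW a b X Y == P)%MS -> isLambda P L ->
  exists2 c : C, c != 0 & L = fun S T => c * lamXY a b X Y S T.
Proof.
move=> rP Xu Yu sP [c0 [L0 [c0nz [/isLambdaRep_lamXY + /lopEqP ->]]]].
case=> a' [b' [X' [Y' [_ X'u Y'u sP' ->]]]].
have /submxP [W EW] : (spanW a' b' X' Y' <= spanW a b X Y)%MS.
  by rewrite (eqmxP sP') (eqmxP sP).
have Wu : W \in unitmx.
  rewrite -row_full_unit -col_leq_rank -{1}rP -(eqmx_rank sP').
  by rewrite EW mxrankM_maxl.
have d0 (Z : 'M[C]_n) : Z \in unitmx -> \det Z != 0 by rewrite unitmxE unitfE.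
exists (c0 * (\det X')^-1 * (\det W * \det X)).
  by rewrite !mulf_neq0 ?invr_eq0 ?d0.
apply/lopEqP => S T; have [ST|ST] := eqVneq #|S| #|T|; last first.
  by rewrite !lamXY_deg ?mulr0.
rewrite -!mulrA; congr (_ * _).
have := plucker_mulmx W (spanW a b X Y) S T.
rewrite -EW !plucker_spanW // -!/(lamXY _ _ _ _) => <-.
by rewrite mulKf ?d0.
Qed.

End Lop.

(** * Limits along filters *)

Section Tends.
Variables (K : numFieldType) (F : set_system nat).

(** The radius is taken in [K] itself; a positive complex number is real, so one notion serves both
    [R] and [C]. *)
Definition tends (u : nat -> K) (a : K) :=
  forall eps : K, 0 < eps -> F (fun k => `|u k - a| < eps).

Context {FF : Filter F}.

Lemma tends_cst a : tends (fun=> a) a.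
Proof. by move=> e e0; apply: filterE => k; rewrite subrr normr0. Qed.

Lemma tends_ext (u v : nat -> K) a : u =1 v -> tends u a -> tends v a.
Proof. by move=> uv ua e e0; apply: filterS (ua e e0) => k; rewrite uv. Qed.

Lemma tendsD (u v : nat -> K) a b :
  tends u a -> tends v b -> tends (fun k => u k + v k) (a + b).
Proof.
move=> ua vb e e0; have e2 : 0 < e / 2 by rewrite divr_gt0.
apply: filterS2 (ua _ e2) (vb _ e2) => k uk vk.
rewrite opprD addrACA (le_lt_trans (ler_normD _ _)) //.
by rewrite [ltRHS](splitr e) ltrD.
Qed.

Lemma tendsM (u v : nat -> K) a b :
  tends u a -> tends v b -> tends (fun k => u k * v k) (a * b).
Proof.
move=> ua vb e e0.
pose s := 1 + `|a| + `|b|; have s0 : 0 < s by rewrite /s -addrA ltr_pwDl // addr_ge0.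
(* [d < 1] bounds the quadratic error by [d], and the total error bound
   [d * s = d * (1 + |a| + |b|)] is below [e]. *)
pose d := e / (e + s).
have es : 0 < e + s by rewrite addr_gt0.
have d0 : 0 < d by rewrite divr_gt0.
have d1 : d < 1 by rewrite ltr_pdivrMr // mul1r ltrDl.
have ds : d * s < e.
  by rewrite /d mulrAC ltr_pdivrMr // ltr_pM2l // ltrDr.
apply: filterS2 (ua _ d0) (vb _ d0) => k /ltW uk /ltW vk.
have -> : u k * v k - a * b = (u k - a) * (v k - b) + a * (v k - b) + (u k - a) * b.
  by ring.
apply: le_lt_trans ds; apply: le_trans (ler_normD _ _) _.
have -> : d * s = d + d * `|a| + d * `|b| by rewrite /s; ring.
apply: lerD.
  apply: le_trans (ler_normD _ _) _; rewrite !normrM; apply: lerD.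
    rewrite -[leRHS]mulr1; apply: ler_pM => //.
    exact: le_trans vk (ltW d1).
  by rewrite mulrC ler_wpM2r.
by rewrite normrM ler_wpM2r.
Qed.

Lemma tends_sum (I : Type) (r : seq I) (P : pred I) (u : I -> nat -> K) (a : I -> K) :
  (forall i, P i -> tends (u i) (a i)) ->
  tends (fun k => \sum_(i <- r | P i) u i k) (\sum_(i <- r | P i) a i).
Proof.
move=> ua; elim: r => [|i r IH].
  by rewrite big_nil; apply: tends_ext (tends_cst 0) => k; rewrite big_nil.
rewrite big_cons; case: ifP => Pi.
  by apply: tends_ext (tendsD (ua i Pi) IH) => k; rewrite big_cons Pi.
by apply: tends_ext IH => k; rewrite big_cons Pi.
Qed.

Lemma tends_prod (I : Type) (r : seq I) (P : pred I) (u : I -> nat -> K) (a : I -> K) :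
  (forall i, P i -> tends (u i) (a i)) ->
  tends (fun k => \prod_(i <- r | P i) u i k) (\prod_(i <- r | P i) a i).
Proof.
move=> ua; elim: r => [|i r IH].
  by rewrite big_nil; apply: tends_ext (tends_cst 1) => k; rewrite big_nil.
rewrite big_cons; case: ifP => Pi.
  by apply: tends_ext (tendsM (ua i Pi) IH) => k; rewrite big_cons Pi.
by apply: tends_ext IH => k; rewrite big_cons Pi.
Qed.

Lemma tends_det n (A : nat -> 'M[K]_n) (A0 : 'M[K]_n) :
  (forall i j, tends (fun k => A k i j) (A0 i j)) ->
  tends (fun k => \det (A k)) (\det A0).
Proof.
move=> Aij; apply: tends_sum => s _; apply: tendsM; first exact: tends_cst.
by apply: tends_prod => i _.
Qed.

Lemma tends_mulmx m n p (A : nat -> 'M[K]_(m, n)) (A0 : 'M[K]_(m, n))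
    (B : nat -> 'M[K]_(n, p)) (B0 : 'M[K]_(n, p)) :
  (forall i j, tends (fun k => A k i j) (A0 i j)) ->
  (forall i j, tends (fun k => B k i j) (B0 i j)) ->
  forall i j, tends (fun k => (A k *m B k) i j) ((A0 *m B0) i j).
Proof.
move=> Aij Bij i j; rewrite mxE.
apply: (@tends_ext (fun k => \sum_l A k i l * B k l j)) => [k|]; first by rewrite mxE.
by apply: tends_sum => l _; exact: tendsM.
Qed.

End Tends.

Lemma tends_uniq (K : numFieldType) (F : set_system nat) {FF : ProperFilter F}
  (u : nat -> K) a b : tends F u a -> tends F u b -> a = b.
Proof.
move=> ua ub; apply/eqP; rewrite -subr_eq0 -normr_le0; apply/negPn/negP => ab.
have d0 : 0 < `|a - b| / 2.
  rewrite divr_gt0 // lt_def normr_ge0 andbT normr_eq0.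
  by apply: contra ab => /eqP ->; rewrite normr0.
have [k [uk vk]] := filter_ex (filterI (ua _ d0) (ub _ d0)).
have := ltrD uk vk; rewrite -splitr distrC => /(le_lt_trans (ler_normD _ _)).
by rewrite addrA addrNK ltxx.
Qed.

Lemma tends_sub (K : numFieldType) (F G : set_system nat) (u : nat -> K) a :
  (F `<=` G)%classic -> tends F u a -> tends G u a.
Proof. by move=> FG ua e e0; apply: FG; exact: ua. Qed.

(** * Real and complex limits, and limits along ultrafilters *)

Section Complexes.
Variables (R : realType).
Local Notation C := R[i].
Local Open Scope complex_scope.

Lemma normc_def (x : C) : `|x| = (Normc.normc x)%:C.
Proof. by []. Qed.

Lemma cvgC_tends (u : nat -> C) a : cvgC R u a <-> tends eventually u a.
Proof.
split=> ua e e0.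
  have [r r0 ->] : exists2 r, 0 < r & e = r%:C.
    case: e e0 => x y; rewrite ltcE /= => /andP [/eqP -> x0].
    by exists x.
  have [N uN] := ua _ r0.
  by exists N => // k /= Nk; rewrite normc_def ltcR; exact: uN.
have e0' : 0 < e%:C by rewrite ltcR.
have [N _ uN] := ua _ e0'; exists N => k Nk.
by have := uN k Nk; rewrite normc_def ltcR.
Qed.

Lemma tends_real (F : set_system nat) {FF : Filter F} (u : nat -> R) a :
  tends F u a -> tends F (fun k => (u k)%:C) a%:C.
Proof.
move=> ua e; case: e => x y; rewrite ltcE /= => /andP [/eqP -> x0].
apply: filterS (ua _ x0) => k uk.
by rewrite -rmorphB /= normc_def ltcR /= expr0n addr0 sqrtr_sqr.
Qed.

Lemma tends_expR (F : set_system nat) {FF : Filter F} (u : nat -> R) a :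
  tends F u a -> tends F (fun k => expR (u k)) (expR a).
Proof.
move=> ua e e0.
have ca : (expR x @[x --> a] --> expR a)%classic := @continuous_expR R a.
move: ca => /cvgrPdist_lt => /(_ e e0).
case/nbhs_ballP => d /= d0 ad.
apply: filterS (ua d d0) => k uk; rewrite distrC; apply: ad.
by rewrite /ball /= distrC.
Qed.

Section Ultra.
Variables (U : set_system nat) (UU : UltraFilter U).

(** The limit is the supremum of the levels that [u] reaches on a set of [U]; a level above it fails
    on a set of [U], since [U] decides every set. *)
Lemma ultra_bounded (u : nat -> R) M : U (fun k => `|u k| <= M) ->
  exists a, tends U u a.
Proof.
move=> uM; pose A : set R := [set a | U (fun k => a <= u k)]%classic.
have AM : ubound A M.
  move=> a Aa; have [k [ak uk]] := filter_ex (filterI Aa uM).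
  by apply: le_trans ak _; apply: le_trans (ler_norm _) uk.
have A0 : A (- M).
  by apply: filterS uM => k; rewrite ler_norml => /andP [].
have hA : has_sup A by split; [exists (- M) | exists M].
exists (sup A) => e e0.
have [a Aa ae] := sup_adherent e0 hA.
have nA : ~ A (sup A + e / 2).
  move=> /(ub_le_sup hA.2) ; apply/negP; rewrite -ltNge ltrDl divr_gt0 //.
have [//|nU] := in_ultra_setVsetC (fun k => sup A + e / 2 <= u k) UU.
apply: filterS2 Aa nU => k ak /negP; rewrite -ltNge => ku.
rewrite ltr_norml; apply/andP; split.
  by rewrite ltrBrDl (lt_le_trans ae ak).
rewrite ltrBlDl (lt_trans ku) // ltrD2l ltr_pdivrMr // ltr_pMr //.
by rewrite ltr1n.
Qed.

Lemma ultra_boundedC (u : nat -> C) (M : R) : U (fun k => `|u k| <= M%:C) ->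
  exists a, tends U u a.
Proof.
move=> uM.
have hRe (x : C) : `|complex.Re x| <= Normc.normc x.
  case: x => x y /=; rewrite -sqrtr_sqr ler_sqrt ?addr_ge0 ?sqr_ge0 //.
  by rewrite lerDl sqr_ge0.
have hIm (x : C) : `|complex.Im x| <= Normc.normc x.
  case: x => x y /=; rewrite -sqrtr_sqr ler_sqrt ?addr_ge0 ?sqr_ge0 //.
  by rewrite lerDr sqr_ge0.
have [a ua] : exists a, tends U (fun k => complex.Re (u k)) a.
  apply: (@ultra_bounded _ M); apply: filterS uM => k.
  by rewrite normc_def lecR; apply: le_trans.
have [b ub] : exists b, tends U (fun k => complex.Im (u k)) b.
  apply: (@ultra_bounded _ M); apply: filterS uM => k.
  by rewrite normc_def lecR; apply: le_trans.
exists (a%:C + 'i%C * b%:C).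
apply: (tends_ext (u := fun k => (complex.Re (u k))%:C + 'i%C * (complex.Im (u k))%:C)).
  by move=> k; rewrite -complexE.
apply: tendsD; first exact: tends_real.
by apply: tendsM; [exact: tends_cst | exact: tends_real].
Qed.

(** [U] decides each pairwise comparison, so the maximizer can be chosen independently of [k]. *)
Lemma ultra_argmax (I : finType) (i0 : I) (f : I -> nat -> R) :
  exists i, U (fun k => forall j, f j k <= f i k).
Proof.
suff [i iI ii] : exists2 i, i \in i0 :: enum I &
    U (fun k => forall j, j \in i0 :: enum I -> f j k <= f i k).
  exists i; apply: filterS ii => k ii j; apply: ii.
  by rewrite inE mem_enum orbT.
elim: (enum I) (i0) => [|i s IH] j0.
  by exists j0; rewrite ?inE //; apply: filterE => k j; rewrite inE => /eqP ->.
have [j js jj] := IH i.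
have [Uj|Uj] := in_ultra_setVsetC (fun k => f j k <= f j0 k) UU.
  exists j0; first by rewrite inE eqxx.
  apply: filterS2 jj Uj => k jj Uj l; rewrite inE => /orP [/eqP -> //|ls].
  exact: le_trans (jj _ ls) Uj.
exists j; first by rewrite inE js orbT.
apply: filterS2 jj Uj => k jj /negP; rewrite -ltNge => /ltW Uj l.
by rewrite inE => /orP [/eqP -> //|ls]; exact: jj.
Qed.

End Ultra.
End Complexes.

(** * Total preorders on Q^n *)

Section FourierMotzkin.

Lemma rat_separation (lo hi : seq rat) :
  (forall x y, x \in lo -> y \in hi -> x < y) ->
  exists t, (forall x, x \in lo -> x < t) /\ (forall y, y \in hi -> t < y).
Proof.
move=> lohi; case: hi => [|y0 hi] in lohi *.
  exists (\big[Num.max/0]_(x <- lo) x + 1); split=> // x xlo.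
  by apply: (le_lt_trans (@le_bigmax_seq _ _ _ _ 0 x predT id xlo isT)); rewrite ltrDl.
pose m := \big[Num.min/y0]_(y <- hi) y.
have m_le y : y \in y0 :: hi -> m <= y.
  rewrite inE => /orP [/eqP ->|yhi]; first exact: bigmin_le_id.
  exact: (@ge_bigmin_seq _ _ _ _ y0 y predT id yhi isT).
have m_in : m \in y0 :: hi.
  rewrite /m; elim: (hi) => [|y h IH]; first by rewrite big_nil inE.
  rewrite big_cons /Num.min; case: ifP => _; first by rewrite !inE eqxx orbT.
  by move: IH; rewrite !inE => /orP [->|->] //; rewrite !orbT.
(* The default [m - 1] keeps [M < m] when [lo] is empty. *)
pose M := \big[Num.max/m - 1]_(x <- lo) x.
have Mm : M < m.
  rewrite /M; elim: (lo) (fun x (h : x \in lo) => lohi x m h m_in) => [|x l IH] h.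
    by rewrite big_nil; lra.
  rewrite big_cons gt_max h ?inE ?eqxx //= IH // => z zl.
  by apply: h; rewrite inE zl orbT.
exists ((M + m) / 2); split=> [x xlo|y yhi].
  have : x <= M by exact: (@le_bigmax_seq _ _ _ _ (m - 1) x predT id xlo isT).
  by lra.
by have := m_le y yhi; lra.
Qed.

(* Q is the nonnegative cone of a total preorder of the Q-vector space Q^n. *)
Lemma total_cone_realizable n (Q : 'rV[rat]_n -> Prop) (s : seq 'rV[rat]_n) :
  (forall a b, Q a -> Q b -> Q (a + b)) ->
  (forall q a, 0 <= q -> Q a -> Q (q *: a)) ->
  (forall a, Q a \/ Q (- a)) ->
  exists m : 'cV[rat]_n, forall a, a \in s -> Q a <-> 0 <= (a *m m) 0 0.
Proof.
elim: n Q s => [|n IH] Q s QD QZ Qt.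
  have Q0 : Q 0 by have [h|h] := Qt 0; [|rewrite oppr0 in h]; exact: h.
  by exists 0 => a _; rewrite mulmx0 mxE lexx [a]thinmx0.
pose lift (a : 'rV[rat]_n) : 'rV[rat]_(1 + n) := row_mx 0 a.
have liftD a b : lift (a + b) = lift a + lift b by rewrite /lift add_row_mx addr0.
have liftN a : lift (- a) = - lift a by rewrite /lift opp_row_mx oppr0.
have liftZ q a : lift (q *: a) = q *: lift a by rewrite /lift scale_row_mx scaler0.
pose e : 'rV[rat]_(1 + n) := row_mx 1%:M 0.
pose c0 (a : 'rV[rat]_(1 + n)) : rat := lsubmx a 0 0.
(* Off the hyperplane [c0 a = 0], [a] is a multiple of [e - lift (xi a)], so membership in [Q]
   compares [e] with the threshold [xi a]. *)
pose xi (a : 'rV[rat]_(1 + n)) : 'rV[rat]_n := (- (c0 a)^-1) *: rsubmx a.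
have decomp a : a = c0 a *: e + lift (rsubmx a).
  rewrite -[LHS](hsubmxK a) /e /lift scale_row_mx scaler0 add_row_mx addr0 add0r.
  by rewrite scalemx1 /c0 -mx11_scalar.
have decomp_xi a : c0 a != 0 -> a = c0 a *: (e - lift (xi a)).
  move=> a0; rewrite {1}[a]decomp /xi liftZ scalerBr scalerA mulrN divff //.
  by rewrite scaleN1r opprK.
pose nz := [seq a <- s | c0 a != 0].
(* Elimination of the first coordinate: the differences of thresholds join the list, so that [m]
   orders the thresholds as [Q] does. *)
have [m m_s] := IH (fun a => Q (lift a))
  ([seq rsubmx (a : 'rV_(1 + n)) | a <- s] ++ [seq xi a - xi b | a <- nz, b <- nz])
  (fun a b Qa Qb => eq_ind_r Q (QD _ _ Qa Qb) (liftD a b))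
  (fun q a q0 Qa => eq_ind_r Q (QZ q _ q0 Qa) (liftZ q a))
  (fun a => eq_ind_r (fun x => _ \/ Q x) (Qt (lift a)) (liftN a)).
pose mu (a : 'rV[rat]_n) := (a *m m) 0 0.
have muxi a b : a \in nz -> b \in nz -> Q (lift (xi a) - lift (xi b)) <-> mu (xi b) <= mu (xi a).
  move=> ha hb; rewrite -liftN -liftD m_s; last first.
    by rewrite mem_cat; apply/orP; right; apply/allpairsP; exists (a, b).
  by rewrite mulmxBl mxE [(- _ : 'M_1) 0 0]mxE subr_ge0.
have [t [tge tle]] : exists t, (forall a, a \in nz -> Q (e - lift (xi a)) <-> mu (xi a) <= t) /\
    (forall a, a \in nz -> Q (lift (xi a) - e) <-> t <= mu (xi a)).
  have tr x y z : Q (x - y) -> Q (y - z) -> Q (x - z).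
    by move=> Qxy /(QD _ _ Qxy); rewrite addrA subrK.
  (* [t] will be the value at [e]. A threshold equivalent to [e] forces it; otherwise every
     threshold is strictly below or above [e], and any separating rational works. *)
  have [[a [anz Qa Qa']]|none] := pselect (exists a, [/\ a \in nz,
      Q (e - lift (xi a)) & Q (lift (xi a) - e)]).
    exists (mu (xi a)); split=> b bnz; rewrite -muxi //; split=> h.
    - exact: tr Qa' h.
    - exact: tr Qa h.
    - exact: tr h Qa.
    - exact: tr h Qa'.
  pose lo := [seq mu (xi a) | a <- nz & `[< Q (e - lift (xi a)) >]].
  pose hi := [seq mu (xi a) | a <- nz & `[< Q (lift (xi a) - e) >]].
  have [|t [tlo thi]] := @rat_separation lo hi.
    move=> _ _ /mapP [a + ->] /mapP [b + ->].
    rewrite mem_filter => /andP [/asboolP Qa anz].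
    rewrite mem_filter => /andP [/asboolP Qb bnz].
    rewrite ltNge; apply/negP => h; apply: none; exists a; split=> //.
    exact: tr ((muxi a b anz bnz).2 h) Qb.
  have inlo a : a \in nz -> Q (e - lift (xi a)) -> mu (xi a) < t.
    move=> anz Qa; apply/tlo/mapP; exists a => //.
    by rewrite mem_filter anz andbT; apply/asboolP.
  have inhi a : a \in nz -> Q (lift (xi a) - e) -> t < mu (xi a).
    move=> anz Qa; apply/thi/mapP; exists a => //.
    by rewrite mem_filter anz andbT; apply/asboolP.
  have tot a : Q (e - lift (xi a)) \/ Q (lift (xi a) - e).
    by rewrite -[lift (xi a) - e]opprB; exact: Qt.
  exists t; split=> a anz; split=> h.
  - exact/ltW/inlo.
  - by case: (tot a) => // /(inhi _ anz); rewrite ltNge h.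
  - exact/ltW/inhi.
  - by case: (tot a) => // /(inlo _ anz); rewrite ltNge h.
exists (col_mx t%:M m : 'cV_(1 + n)); move=> a'; move: (a' : 'rV[rat]_(1 + n)) => {a'} a sa.
have val : (@mulmx _ 1 (1 + n) 1 a (col_mx t%:M m)) 0 0 = c0 a * t + mu (rsubmx a).
  by rewrite -{1}(@hsubmxK _ 1 1 n a) mul_row_col mxE mul_mx_scalar mxE mulrC.
rewrite val; have [a0|a0] := eqVneq (c0 a) 0.
  rewrite {1}[a]decomp a0 scale0r add0r mul0r add0r; apply: m_s.
  by rewrite mem_cat; apply/orP; left; apply/mapP; exists a.
have anz : a \in nz by rewrite mem_filter a0.
have -> : mu (rsubmx a) = - c0 a * mu (xi a).
  rewrite /mu /xi -scalemxAl; set z := rsubmx a *m m.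
  by rewrite [(_ *: z : 'M_1) 0 0]mxE mulrA mulrNN divff // mul1r.
rewrite mulNr -mulrBr {1}(decomp_xi a a0).
have Qpos q x : 0 < q -> Q (q *: x) <-> Q x.
  move=> q0; split; last exact/QZ/ltW.
  by move/(QZ q^-1); rewrite scalerA mulVf ?gt_eqF // scale1r; apply; rewrite invr_ge0 ltW.
case: (ltgtP (c0 a) 0) a0 => // ca _.
  rewrite -[c0 a]opprK scaleNr -scalerN opprB Qpos ?oppr_gt0 // tle //.
  by rewrite nmulr_rge0 ?opprK // subr_le0.
by rewrite Qpos // tge // pmulr_rge0 // subr_ge0.
Qed.

End FourierMotzkin.

(** * Complete pivoting *)

Section Pivoting.
Variable R : realType.
Local Notation C := R[i].
Local Open Scope complex_scope.

Definition bounded_mx m n (K : nat) (A : 'M[C]_(m, n)) := forall i j, `|A i j| <= K%:R.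

Lemma bounded_mulmx m n p (a b : nat) (A : 'M[C]_(m, n)) (B : 'M[C]_(n, p)) :
  bounded_mx a A -> bounded_mx b B -> bounded_mx (n * (a * b)) (A *m B).
Proof.
move=> Aa Bb i j; rewrite mxE (le_trans (ler_norm_sum _ _ _)) //.
apply: (@le_trans _ _ (\sum_(k < n) a%:R * b%:R)); last first.
  by rewrite sumr_const card_ord !natrM [leRHS]mulr_natl.
by apply: ler_sum => k _; rewrite normrM ler_pM.
Qed.

Lemma bounded_mx_le m n (a b : nat) (A : 'M[C]_(m, n)) :
  (a <= b)%N -> bounded_mx a A -> bounded_mx b A.
Proof. by move=> ab Aa i j; rewrite (le_trans (Aa i j)) // ler_nat. Qed.

Lemma bounded_block m1 m2 n1 n2 K (A : 'M[C]_(m1, n1)) (B : 'M[C]_(m1, n2))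
    (A' : 'M[C]_(m2, n1)) (B' : 'M[C]_(m2, n2)) :
  bounded_mx K A -> bounded_mx K B -> bounded_mx K A' -> bounded_mx K B' ->
  bounded_mx K (block_mx A B A' B').
Proof.
move=> hA hB hA' hB' i j; rewrite -(splitK i) -(splitK j).
case: (split i) => k; case: (split j) => l /=.
- by rewrite block_mxEul.
- by rewrite block_mxEur.
- by rewrite block_mxEdl.
- by rewrite block_mxEdr.
Qed.

Lemma bounded0 m n K : bounded_mx K (0 : 'M[C]_(m, n)).
Proof. by move=> i j; rewrite mxE normr0. Qed.

Lemma bounded1 n K : (0 < K)%N -> bounded_mx K (1%:M : 'M[C]_n).
Proof.
move=> K0 i j; rewrite mxE; case: eqP => _; rewrite ?normr0 // normr1.
by rewrite (ler_nat _ 1).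
Qed.

Lemma bounded_perm n (s : {perm 'I_n}) : bounded_mx 1 (perm_mx s : 'M[C]_n).
Proof. by move=> i j; rewrite !mxE; case: eqP => _; rewrite ?normr0 ?normr1. Qed.

Lemma block_diag_mul m n (A A' : 'M[C]_m) (B B' : 'M[C]_n) :
  block_mx A 0 0 B *m block_mx A' 0 0 B' = block_mx (A *m A') 0 0 (B *m B').
Proof. by rewrite mulmx_block !mulmx0 !mul0mx !addr0 add0r. Qed.

Lemma mulmx3_inv n (A1 A2 A3 B1 B2 B3 : 'M[C]_n) :
  A1 *m B1 = 1%:M -> A2 *m B2 = 1%:M -> A3 *m B3 = 1%:M ->
  (A1 *m A2 *m A3) *m (B3 *m B2 *m B1) = 1%:M.
Proof.
move=> h1 h2 h3; rewrite !mulmxA -[_ *m A3 *m B3]mulmxA h3 mulmx1.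
by rewrite -[_ *m A2 *m B2]mulmxA h2 mulmx1.
Qed.

Definition real_diag n (d : 'rV[R]_n) : 'M[C]_n := diag_mx (map_mx (real_complex R) d).

(* Gaussian elimination with complete pivoting: a pivot is at most twice the
   previous one, so the powers of 2 moved into U make the diagonal decreasing
   while the outer factors stay in a fixed compact subset of GL_n. *)
Lemma pivoting n : exists K : nat, forall g : 'M[C]_n, g \in unitmx ->
  exists U U' V V' : 'M[C]_n, exists d : 'rV[R]_n,
  [/\ g = U *m real_diag d *m V, U *m U' = 1%:M, V *m V' = 1%:M,
      [/\ bounded_mx K U, bounded_mx K U', bounded_mx K V & bounded_mx K V'] &
      [/\ forall i, 0 < d 0 i, forall i j : 'I_n, (i <= j)%N -> d 0 j <= d 0 i &
          forall M : R, (forall i j, `|g i j| <= M%:C) -> forall i, d 0 i <= M]].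
Proof.
elim: n => [|n [K IH]].
  exists 0 => g _; exists 1%:M, 1%:M, 1%:M, 1%:M, 0.
  split; rewrite ?mulmx1 //; last by split=> [[]|[]|? _ []].
    by apply/matrixP => [[]].
  by split=> [[]|[]|[]|[]].
(* Each outer factor is a product of a permutation and a unipotent matrix, both with entries of
   modulus at most 1, and a block matrix bounded by [1 + 2 * K]; each multiplication costs a factor
   [N]. *)
pose N := n.+1; exists (N * (N * (1 * 1) * (1 + 2 * K)))%N => g gu.
pose x0 := [arg max_(x > (ord0, ord0) : 'I_n.+1 * 'I_n.+1) Normc.normc (g x.1 x.2)]%O.
have x0P i j : `|g i j| <= `|g x0.1 x0.2|.
  rewrite /x0; case: arg_maxP => // x _ /(_ (i, j) isT) /=.
  by move=> h; rewrite /Num.norm /= lecR.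
set i0 := x0.1 in x0P; set j0 := x0.2 in x0P; set p := g i0 j0 in x0P.
have p0 : p != 0.
  apply/eqP => p0; have g0 : g = 0.
    apply/matrixP => i j; rewrite mxE; apply/eqP.
    by rewrite -normr_le0 (le_trans (x0P i j)) // p0 normr0.
  by move: gu; rewrite unitmxE unitfE g0 det0 eqxx.
have np0 : `|p| != 0 by rewrite normr_eq0.
pose q := Normc.normc p.
have qE : `|p| = q%:C by [].
have q0 : 0 < q by rewrite -ltcR -qE normr_gt0.
pose P : 'M[C]_(1 + n) := tperm_mx i0 0.
pose Q : 'M[C]_(1 + n) := tperm_mx j0 0.
have PP : P *m P = 1%:M by rewrite -perm_mxM tperm2 perm_mx1.
have QQ : Q *m Q = 1%:M by rewrite -perm_mxM tperm2 perm_mx1.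
pose h : 'M[C]_(1 + n) := P *m g *m Q.
have hE i j : h i j = g (tperm i0 0 i) (tperm j0 0 j).
  by rewrite /h -xcolE -xrowE !mxE.
have gE : g = P *m h *m Q by rewrite /h -!mulmxA QQ mulmx1 !mulmxA PP mul1mx.
have hp i j : `|h i j| <= `|p| by rewrite hE x0P.
pose r : 'rV[C]_n := p^-1 *: ursubmx h; pose c : 'cV[C]_n := p^-1 *: dlsubmx h.
have pr : p *: r = ursubmx h by rewrite scalerA divff ?scale1r.
have pc : p *: c = dlsubmx h by rewrite scalerA divff ?scale1r.
have div1 (z : C) : `|z| <= `|p| -> `|p^-1 * z| <= 1.
  by move=> zp; rewrite normrM normfV mulrC ler_pdivrMr ?mul1r // normr_gt0.
have rb : bounded_mx 1 r by move=> i j; rewrite mxE div1 // 2!mxE hp.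
have cb : bounded_mx 1 c by move=> i j; rewrite mxE div1 // 2!mxE hp.
pose B := drsubmx h - p *: (c *m r).
pose Lo : 'M[C]_(1 + n) := block_mx 1%:M 0 c 1%:M.
pose Lo' : 'M[C]_(1 + n) := block_mx 1%:M 0 (- c) 1%:M.
pose Up : 'M[C]_(1 + n) := block_mx 1%:M r 0 1%:M.
pose Up' : 'M[C]_(1 + n) := block_mx 1%:M (- r) 0 1%:M.
have h00 : ulsubmx h = p%:M.
  rewrite [LHS]mx11_scalar 2!mxE hE; congr (g _ _)%:M.
    by rewrite (_ : lshift n 0 = 0) ?tpermR //; apply: val_inj.
  by rewrite (_ : lshift n 0 = 0) ?tpermR //; apply: val_inj.
have LDU : h = Lo *m block_mx p%:M 0 0 B *m Up.
  rewrite /Lo /Up !mulmx_block !mulmx0 !mul0mx !mul1mx !mulmx1 !addr0 !add0r.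
  rewrite -{1}[h]submxK h00 mul_scalar_mx pr mul_mx_scalar pc.
  by rewrite -pc -scalemxAl /B addrC subrK.
have LL : Lo *m Lo' = 1%:M.
  rewrite mulmx_block !mulmx0 !mul0mx !mul1mx !mulmx1 !addr0 !add0r subrr.
  by rewrite -scalar_mx_block.
have UU : Up *m Up' = 1%:M.
  rewrite mulmx_block !mulmx0 !mul0mx !mul1mx !mulmx1 !addr0 !add0r addNr.
  by rewrite -scalar_mx_block.
have Bu : B \in unitmx.
  have : h \in unitmx by rewrite /h !unitmx_mul gu !unitmx_perm.
  by rewrite LDU !unitmx_mul !unitmxE det_ublock unitrM => /andP [/andP [_ /andP []]].
have [U [U' [V [V' [d [BE UU' VV' [Ub U'b Vb V'b] [d0 ddec dM]]]]]]] := IH B Bu.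
(* No entry of [h] exceeds the pivot in modulus, so those of the Schur complement [B] are at most
   [2 * q]; the bound clause of the induction hypothesis passes this on to [d]. *)
have dp i : d 0 i <= 2 * q.
  apply: dM => {}i j; rewrite rmorphM /= -qE rmorph_nat mulr_natl mulr2n.
  have -> : B i j = drsubmx h i j - p * (c i 0 * r 0 j).
    by rewrite [LHS]mxE; congr (_ + _); rewrite 3!mxE big_ord1.
  rewrite (le_trans (ler_normB _ _)) // lerD //; first by rewrite 2!mxE hp.
  by rewrite normrM ger_pMr ?normr_gt0 // normrM mulr_ile1.
(* The phase of the pivot goes into the right factor, so that the diagonal is positive real. *)
pose f := p / `|p|.
have nf : `|f| = 1 by rewrite normrM normfV normr_id divff.
have nf' : `|f^-1| = 1 by rewrite normfV nf invr1.
have f0 : f != 0 by rewrite -normr_eq0 nf oner_eq0.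
(* Halving [d] brings it below the pivot; the left factor receives the compensating [2]. *)
pose d' : 'rV[R]_(1 + n) := row_mx q%:M (2^-1 *: d).
have d'0 : d' 0 (lshift n 0) = q by rewrite row_mxEl mxE eqxx mulr1n.
have d'S i : d' 0 (rshift 1 i) = 2^-1 * d 0 i by rewrite row_mxEr mxE.
have dE : real_diag d' = block_mx (`|p|)%:M 0 0 (2^-1 *: real_diag d).
  rewrite /real_diag map_row_mx diag_mx_row; congr (block_mx _ 0 0 _).
    by rewrite map_scalar_mx /= [RHS]mx11_scalar [LHS]mx11_scalar !mxE.
  rewrite map_mxZ -linearZ /=; congr (diag_mx (_ *: _)).
  by rewrite fmorphV rmorph_nat.
exists (P *m Lo *m block_mx 1%:M 0 0 (2 *: U)).
exists (block_mx 1%:M 0 0 (2^-1 *: U') *m Lo' *m P).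
exists (block_mx f%:M 0 0 V *m Up *m Q).
exists (Q *m Up' *m block_mx f^-1%:M 0 0 V').
exists d'.
have two : (2 : C) != 0 by rewrite pnatr_eq0.
split.
- have blkE : block_mx p%:M 0 0 B =
      block_mx 1%:M 0 0 (2 *: U) *m real_diag d' *m block_mx f%:M 0 0 V.
    rewrite dE !block_diag_mul mul1mx; congr (block_mx _ 0 0 _).
      by rewrite -scalar_mxM /f mulrC divfK.
    by rewrite -!scalemxAl -!scalemxAr -scalemxAl scalerA divff // scale1r.
  by rewrite gE LDU blkE !mulmxA.
- apply: (mulmx3_inv PP LL).
  have UU2 : (2 *: U) *m (2^-1 *: U') = 1%:M.
    by rewrite -scalemxAl -scalemxAr scalerA divff // scale1r.
  by rewrite block_diag_mul mul1mx UU2 -scalar_mx_block.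
- apply: (fun h => mulmx3_inv h UU QQ).
  by rewrite block_diag_mul -scalar_mxM divff // VV' -scalar_mx_block.
- have b1 K' (A : 'M[C]_n) : bounded_mx K A -> (K + K <= K')%N -> bounded_mx K' (2 *: A).
    move=> Ab KK i j; rewrite mxE normrM normr_nat mulr_natl.
    apply: le_trans (_ : K%:R *+ 2 <= _); first by rewrite lerMn2r Ab orbT.
    by rewrite -mulrnA ler_nat muln2 -addnn.
  have b2 K' (A : 'M[C]_n) : bounded_mx K A -> (K <= K')%N -> bounded_mx K' (2^-1 *: A).
    move=> Ab KK i j; rewrite mxE normrM normfV normr_nat.
    apply: le_trans (_ : K%:R <= _); last by rewrite ler_nat.
    rewrite mulrC ler_pdivrMr ?ltr0n // (le_trans (Ab i j)) //.
    by rewrite ler_peMr ?ler0n // ler1n.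
  have bs (z : C) K' : `|z| = 1 -> (0 < K')%N -> bounded_mx K' (z%:M : 'M[C]_1).
    by move=> z1 K'0 i j; rewrite !ord1 mxE eqxx mulr1n z1 (ler_nat _ 1).
  have bLo : bounded_mx 1 Lo.
    by apply: bounded_block => //; [exact: bounded1 | exact: bounded0 | exact: bounded1].
  have bN m1 m2 (A : 'M[C]_(m1, m2)) : bounded_mx 1 A -> bounded_mx 1 (- A).
    by move=> Ab i j; rewrite mxE normrN.
  have bLo' : bounded_mx 1 Lo'.
    apply: bounded_block;
      [exact: bounded1 | exact: bounded0 | exact: bN | exact: bounded1].
  have bUp : bounded_mx 1 Up.
    by apply: bounded_block => //; [exact: bounded1 | exact: bounded0 | exact: bounded1].
  have bUp' : bounded_mx 1 Up'.
    apply: bounded_block;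
      [exact: bounded1 | exact: bN | exact: bounded0 | exact: bounded1].
  have bP : bounded_mx 1 P by exact: bounded_perm.
  have bQ : bounded_mx 1 Q by exact: bounded_perm.
  have bblk (A : 'M[C]_1) (D : 'M[C]_n) : bounded_mx (1 + 2 * K) A ->
     bounded_mx (1 + 2 * K) D -> bounded_mx (1 + 2 * K) (block_mx A 0 0 D).
    by move=> hA hD; apply: bounded_block => //; exact: bounded0.
  have e1 := bounded_mulmx.
  split.
  + apply: bounded_mx_le (e1 _ _ _ _ _ _ _ (e1 _ _ _ _ _ _ _ bP bLo) (bblk _ _ _ _)).
    * by rewrite /N add1n.
    * exact: bounded1.
    * by apply: b1 => //; rewrite addnn -mul2n leq_addl.
  + rewrite -mulmxA.
    apply: bounded_mx_le (e1 _ _ _ _ _ _ _ (bblk _ _ _ _) (e1 _ _ _ _ _ _ _ bLo' bP)).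
    * by rewrite /N add1n [((1 + _) * _)%N]mulnC.
    * exact: bounded1.
    * by apply: b2 => //; rewrite (leq_trans (leq_pmull _ (isT : 0 < 2)%N)) // leq_addl.
  + rewrite -mulmxA.
    apply: bounded_mx_le (e1 _ _ _ _ _ _ _ (bblk _ _ _ _) (e1 _ _ _ _ _ _ _ bUp bQ)).
    * by rewrite /N add1n [((1 + _) * _)%N]mulnC.
    * exact: bs.
    * by apply: bounded_mx_le Vb; rewrite (leq_trans (leq_pmull _ (isT : 0 < 2)%N)) // leq_addl.
  + apply: bounded_mx_le (e1 _ _ _ _ _ _ _ (e1 _ _ _ _ _ _ _ bQ bUp') (bblk _ _ _ _)).
    * by rewrite /N add1n.
    * exact: bs.
    * by apply: bounded_mx_le V'b; rewrite (leq_trans (leq_pmull _ (isT : 0 < 2)%N)) // leq_addl.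
have d'q i : 2^-1 * d 0 i <= q.
  by have := dp i; lra.
split.
- move=> i; rewrite -(@splitK 1 n i); case: (@split 1 n i) => k /=.
    by rewrite !ord1 d'0.
  by rewrite d'S mulr_gt0 // invr_gt0 ltr0n.
- move=> i j; rewrite -(@splitK 1 n i) -(@splitK 1 n j).
  case: (@split 1 n i) => k; case: (@split 1 n j) => l /=; rewrite ?ord1 ?d'0 ?d'S //.
  by move=> kl; rewrite ler_pM2l ?invr_gt0 ?ltr0n // ddec.
- move=> M gM i; have qM : q <= M by rewrite -lecR -qE; exact: gM.
  rewrite -(@splitK 1 n i); case: (@split 1 n i) => k /=; rewrite ?ord1 ?d'0 ?d'S //.
  exact: le_trans (d'q _) qM.
Qed.

End Pivoting.

(** * Weights *)

Section InitialSegments.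
Variable n : nat.
Implicit Types (S D : {set 'I_n}).

Definition firsts (k : nat) : {set 'I_n} := [set i : 'I_n | (i < k)%N].

Lemma card_firsts k : (k <= n)%N -> #|firsts k| = k.
Proof.
move=> kn; rewrite -[RHS]card_ord -!sum1_card (big_ord_widen n (fun=> 1%N) kn).
by apply: eq_bigl => i; rewrite inE.
Qed.

Lemma initial_segmentP D : (forall i j : 'I_n, (i <= j)%N -> j \in D -> i \in D) ->
  D = firsts #|D|.
Proof.
move=> Ddown; apply/setP => i; rewrite inE; apply/idP/idP => [iD|].
  rewrite -(@card_firsts i.+1) //; apply: subset_leq_card.
  by apply/subsetP => j; rewrite inE ltnS => ji; exact: Ddown iD.
apply: contraTT => iD; rewrite -leqNgt -[X in (_ <= X)%N](@card_firsts i) ?(ltnW (ltn_ord i)) //.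
apply: subset_leq_card; apply/subsetP => j jD; rewrite inE ltnNge.
by apply: contra iD => ij; exact: Ddown ij jD.
Qed.

Definition wt (V : nmodType) (d : 'I_n -> V) S : V := \sum_(i in S) d i.

Section Top.
Variables (V : realDomainType) (d : 'I_n -> V).

(** For sets of equal size, subtracting [kappa] from every [d i] leaves the difference of weights
    unchanged; it becomes a sum of nonnegative terms supported on the symmetric difference of [S]
    and [firsts #|S|]. *)
Lemma wt_topP S (kappa : V) :
  (forall i : 'I_n, (i < #|S|)%N -> kappa <= d i) ->
  (forall i : 'I_n, (#|S| <= i)%N -> d i <= kappa) ->
  wt d S <= wt d (firsts #|S|) /\
  ((wt d S == wt d (firsts #|S|)) =
   [forall i, ((i \in S) != (i < #|S|)%N) ==> (d i == kappa)]).
Proof.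
move=> hlo hhi; have cS : #|firsts #|S| | = #|S|.
  by rewrite card_firsts // -[X in (_ <= X)%N](card_ord n) max_card.
pose f (i : 'I_n) : V := ((i < #|S|)%N%:R - (i \in S)%:R) * (d i - kappa).
have f0 i : 0 <= f i.
  rewrite /f; have [iS|iS] := ltnP i #|S|; case: (i \in S); rewrite ?subrr ?mul0r //=.
    by rewrite subr0 mul1r subr_ge0 hlo.
  by rewrite sub0r mulN1r opprB subr_ge0 hhi.
have fE : wt d (firsts #|S|) - wt d S = \sum_i f i.
  rewrite /wt; have e (T : {set 'I_n}) :
      \sum_(i in T) d i = \sum_i (i \in T)%:R * (d i - kappa) + #|T|%:R * kappa.
    rewrite [X in _ = _ + X]mulr_natl -sumr_const (eq_bigr (fun i => (d i - kappa) + kappa));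
      last by move=> i _; rewrite subrK.
    rewrite big_split /=; congr (_ + _); rewrite big_mkcond /=; apply: eq_bigr => i _.
    by case: (i \in T); rewrite ?mul1r ?mul0r.
  rewrite !e cS opprD addrACA subrr addr0 -sumrB; apply: eq_bigr => i _.
  by rewrite /f inE mulrBl.
split; first by rewrite -subr_ge0 fE sumr_ge0.
rewrite eq_sym -subr_eq0 fE psumr_eq0 //.
apply/allP/forallP => h i.
  have := h i; rewrite mem_index_enum => /(_ isT) /=; rewrite /f mulf_eq0 [d i - _ == 0]subr_eq0.
  by case: (i \in S); case: (i < #|S|)%N; rewrite //= ?subr0 ?sub0r ?oppr_eq0 oner_eq0.
move=> _ /=; have := h i; rewrite /f mulf_eq0 [d i - _ == 0]subr_eq0.
by case: (i \in S); case: (i < #|S|)%N; rewrite //= ?subrr ?eqxx // => ->; rewrite orbT.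
Qed.

Lemma wt_top_le S : (forall i j : 'I_n, (i <= j)%N -> d j <= d i) ->
  wt d S <= wt d (firsts #|S|).
Proof.
move=> ddec; have [S0|S0] := posnP #|S|.
  rewrite S0; move/eqP: S0; rewrite cards_eq0 => /eqP ->.
  by rewrite /wt !big_set0 ?lexx.
have Sn : (#|S|.-1 < n)%N.
  by rewrite prednK // -[X in (_ <= X)%N](card_ord n) max_card.
apply: (wt_topP (kappa := d (Ordinal Sn)) _ _).1 => i iS; apply: ddec => /=.
  by rewrite -ltnS prednK.
exact: leq_trans (leq_pred _) iS.
Qed.

End Top.
End InitialSegments.

(** * Operators and weights on the tensor products containing H_nu *)

Section TensorOperators.
Variables (R : realType) (n : nat).
Local Notation C := R[i].
Local Notation lop := (lop R n).
Variable nu : 'I_n -> nat.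
Implicit Types (A B : lop) (x : tvec R nu) (S T : tidx nu).

Lemma rT_mul A B x : rT (lop_mul A B) x = rT A (rT B x).
Proof.
apply/funext => S; rewrite /rT /lop_mul.
under [RHS]eq_bigr => U _ do rewrite mulr_sumr.
rewrite exchange_big /=; apply: eq_bigr => T _.
under [RHS]eq_bigr => U _ do rewrite mulrA.
rewrite -mulr_suml; congr (_ * _).
rewrite (bigA_distr_bigA (fun i U => A (S i) U * B U (T i))) /=.
by apply: eq_bigr => U _; rewrite big_split.
Qed.

Lemma rT_dlop d x S : rT (dlop d) x S = (\prod_(i < Nsig nu) d (S i)) * x S.
Proof.
rewrite /rT (bigD1 S) //= [X in _ + X]big1 ?addr0.
  by congr (_ * _); apply: eq_bigr => i _; rewrite /dlop eqxx.
move=> T TS; have [i Ti] : exists i, T i != S i.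
  apply/existsP; apply: contraR TS; rewrite negb_exists => /forallP h.
  by apply/eqP/ffunP => i; have := h i; rewrite negbK => /eqP.
by rewrite (bigD1 i) //= /dlop eq_sym (negbTE Ti) !mul0r.
Qed.

(** [tvec] is a full tensor power of the exterior algebra; these indices span the summand that
    contains [H_nu], where the highest weight is an upper bound. *)
Definition graded S := [forall i : 'I_(Nsig nu), #|S i| == dg nu i].

Definition graded_vec x := forall S, ~~ graded S -> x S = 0.

Lemma rT_graded A x : (forall U W : {set 'I_n}, #|U| != #|W| -> A U W = 0) ->
  graded_vec x -> graded_vec (rT A x).
Proof.
move=> A0 xg S; rewrite negb_forall => /existsP [i Si].
apply: big1 => T _; have [/forallP gT|gT] := boolP (graded T); last by rewrite xg ?mulr0.
by rewrite (bigD1 i) //= A0 ?mul0r // (eqP (gT i)).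
Qed.

Lemma dg_le i : (dg nu i <= n)%N.
Proof. by rewrite -[X in (_ <= X)%N](card_ord n) max_card. Qed.

Definition top_idx : tidx nu := [ffun i : 'I_(Nsig nu) => firsts n (dg nu i)].

Lemma graded_top : graded top_idx.
Proof. by apply/forallP => i; rewrite ffunE card_firsts // dg_le. Qed.

Lemma XiE S : @Xi R n nu S = (S == top_idx)%:R.
Proof.
rewrite /Xi; have -> : (S == top_idx) = [forall i, S i == firsts n (dg nu i)].
  apply/eqP/forallP => [-> i|h]; first by rewrite ffunE.
  by apply/ffunP => i; rewrite ffunE; exact/eqP.
by rewrite /firsts; case: ifP.
Qed.

Lemma Xi_graded : graded_vec (@Xi R n nu).
Proof. by move=> S; rewrite XiE; case: eqP => // ->; rewrite graded_top. Qed.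

Lemma inH_graded x : inH x -> graded_vec x.
Proof.
case=> K [coef [gs [_ xE]]] S gS; rewrite xE big1 // => k _.
by rewrite (rT_graded (@lam_neq R n (gs k)) Xi_graded) ?mulr0.
Qed.

Lemma inH_0 : inH (fun _ : tidx nu => 0 : C).
Proof.
exists 0, (fun=> 0), (fun=> 1%:M); split=> [[]//|S].
by rewrite big_ord0.
Qed.

Lemma inH_rT (g : 'M[C]_n) : g \in unitmx -> inH (rT (lam_cha g) (@Xi R n nu)).
Proof.
move=> gu; exists 1, (fun=> 1), (fun=> g); split=> // S.
by rewrite big_ord1 mul1r.
Qed.

Definition twt (V : nmodType) (d : 'I_n -> V) S : V :=
  \sum_(i < Nsig nu) wt d (S i).

Lemma twt_count (V : nmodType) (d : 'I_n -> V) S :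
  twt d S = \sum_j d j *+ #|[set i | j \in S i]|.
Proof.
rewrite /twt /wt; under eq_bigr => i _ do rewrite big_mkcond.
rewrite exchange_big; apply: eq_bigr => j _ /=.
rewrite -sumr_const [RHS]big_mkcond /=; apply: eq_bigr => i _; rewrite inE.
by [].
Qed.

Section Signature.
Hypothesis nu_sig : isSignature nu.

(** [dg nu] is the conjugate partition of [nu]: since [nu] decreases, the set counted by [dg nu i]
    is an initial segment. *)
Lemma dg_lt i (j : 'I_n) : (j < dg nu i)%N = (i < nu j)%N.
Proof.
have -> : dg nu i = #|[set j : 'I_n | (i < nu j)%N]| by [].
have h : [set j : 'I_n | (i < nu j)%N] = firsts n #|[set j : 'I_n | (i < nu j)%N]|.
  apply: initial_segmentP => a b ab.
  by rewrite !inE => /leq_trans; apply; exact: nu_sig.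
by move/setP/(_ j): h; rewrite !inE => ->.
Qed.

(** By conjugation [j] occurs in exactly [nu j] factors of [top_idx], so the weight of [Xi] is the
    highest weight [nu]. *)
Lemma twt_top (V : pzSemiRingType) (d : 'I_n -> V) :
  twt d top_idx = \sum_j d j *+ nu j.
Proof.
rewrite twt_count; apply: eq_bigr => j _; congr (_ *+ _).
have -> : [set i | j \in top_idx i] = firsts (Nsig nu) (nu j).
  by apply/setP => i; rewrite !inE ffunE inE dg_lt.
by rewrite card_firsts // /Nsig (leq_bigmax j).
Qed.

(** Equality is decided factor by factor: on graded indices, the projection onto the top weights is
    the tensor product of the projections in the factors. *)
Lemma twt_top_le (V : realDomainType) (d : 'I_n -> V) S :
  (forall i j : 'I_n, (i <= j)%N -> d j <= d i) -> graded S ->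
  twt d S <= twt d top_idx ?= iff [forall i, wt d (S i) == wt d (firsts n #|S i|)].
Proof.
move=> ddec /forallP gS; apply: leif_sum => i _.
by rewrite ffunE -(eqP (gS i)); split; first exact: wt_top_le.
Qed.

End Signature.
End TensorOperators.

(** * Blocks of a spike index *)

Section Blocks.
Variables (n : nat) (m : 'I_n -> int).
Hypothesis m_dec : forall i j : 'I_n, (i <= j)%N -> m j <= m i.
Local Notation kv j := (nth 0 (kvals n m) j).

(* The distinct values of m occupy the blocks [seg j, seg j.+1) of indices. *)
Definition seg (j : nat) : nat := \sum_(t < j) alpha n m t.

Definition blk (i : 'I_n) : nat := index (m i) (kvals n m).

Lemma mem_kvals x : (x \in kvals n m) = [exists i, m i == x].
Proof.
rewrite /kvals mem_sort mem_undup; apply/mapP/existsP.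
  by case=> i _ ->; exists i.
by case=> i /eqP <-; exists i; rewrite ?mem_enum.
Qed.

Lemma blk_lt i : (blk i < tau n m)%N.
Proof. by rewrite /blk index_mem mem_kvals; apply/existsP; exists i. Qed.

Lemma kv_blk i : kv (blk i) = m i.
Proof. by rewrite nth_index // mem_kvals; apply/existsP; exists i. Qed.

Lemma kv_le j j' : (j <= j')%N -> (j' < tau n m)%N -> kv j' <= kv j.
Proof.
move=> jj' j't.
have srt : sorted (fun x y : int => y <= x) (kvals n m).
  by apply: sort_sorted => x y; exact: le_total.
apply: (sorted_leq_nth _ _ _ srt) => //.
- by move=> x y z xy yz; exact: le_trans yz xy.
- by rewrite inE; exact: leq_ltn_trans jj' j't.
Qed.

Lemma kv_lt j j' : (j < j')%N -> (j' < tau n m)%N -> kv j' < kv j.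
Proof.
move=> jj' j't; rewrite lt_neqAle kv_le ?(ltnW jj') // andbT.
rewrite nth_uniq ?(ltn_trans jj') //; first by rewrite gtn_eqF.
by rewrite /kvals sort_uniq undup_uniq.
Qed.

Lemma kv_mono j j' : (j < tau n m)%N -> (j' < tau n m)%N -> (kv j <= kv j') = (j' <= j)%N.
Proof.
move=> jt jt'; have [jj'|jj'] := leqP j' j; first by rewrite kv_le.
by apply/negbTE; rewrite -ltNge kv_lt.
Qed.

Lemma alpha_gt0 j : (j < tau n m)%N -> (0 < alpha n m j)%N.
Proof.
move=> jt; have : kv j \in kvals n m by rewrite mem_nth.
rewrite mem_kvals => /existsP [i mi]; rewrite /alpha card_gt0.
by apply/set0Pn; exists i; rewrite inE.
Qed.

Lemma segS j : seg j.+1 = (seg j + alpha n m j)%N.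
Proof. by rewrite /seg big_ord_recr. Qed.

Lemma seg0 : seg 0 = 0%N.
Proof. by rewrite /seg big_ord0. Qed.

Lemma firsts_of (Q : pred 'I_n) : (forall i j : 'I_n, (i <= j)%N -> Q j -> Q i) ->
  forall i : 'I_n, (i < #|[set i | Q i]|)%N = Q i.
Proof.
move=> Qd i; have /setP/(_ i) : [set i | Q i] = firsts n #|[set i | Q i]|.
  by apply: initial_segmentP => a b ab; rewrite !inE; exact: Qd.
by rewrite !inE.
Qed.

Lemma seg_card j : (j < tau n m)%N ->
  seg j = #|[set i | kv j < m i]| /\ seg j.+1 = #|[set i | kv j <= m i]|.
Proof.
have step k : seg k = #|[set i | kv k < m i]| -> seg k.+1 = #|[set i | kv k <= m i]|.
  move=> sk; rewrite segS sk /alpha -cardsUI [X in (_ + #|pred_of_set X|)%N](_ : _ = set0).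
    rewrite cards0 addn0; apply: eq_card => i; rewrite !inE le_eqVlt orbC.
    by rewrite eq_sym.
  by apply/setP => i; rewrite !inE; case: eqP => [->|]; rewrite ?ltxx ?andbF.
move=> jt; suff h : seg j = #|[set i | kv j < m i]| by split=> //; exact: step.
elim: j jt => [|j IH] jt.
  rewrite seg0; apply/esym/eqP; rewrite cards_eq0; apply/eqP/setP => i.
  by rewrite !inE -kv_blk; apply/negbTE; rewrite -leNgt kv_le ?blk_lt.
rewrite step ?IH ?(ltnW jt) //; apply: eq_card => i; rewrite !inE.
rewrite -kv_blk ltNge !kv_mono ?blk_lt ?(ltnW jt) //.
by rewrite -ltnNge ltnS.
Qed.

Lemma seg_lt j (i : 'I_n) : (j < tau n m)%N -> (i < seg j)%N = (kv j < m i).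
Proof.
move=> jt; rewrite (seg_card jt).1; apply: (firsts_of (Q := fun i => kv j < m i)).
by move=> a b ab /lt_le_trans; apply; exact: m_dec.
Qed.

Lemma seg_ltS j (i : 'I_n) : (j < tau n m)%N -> (i < seg j.+1)%N = (kv j <= m i).
Proof.
move=> jt; rewrite (seg_card jt).2; apply: (firsts_of (Q := fun i => kv j <= m i)).
by move=> a b ab /le_trans; apply; exact: m_dec.
Qed.

Lemma seg_blk (i : 'I_n) j : (j < tau n m)%N -> (i < seg j)%N = (blk i < j)%N.
Proof.
by move=> jt; rewrite seg_lt // -kv_blk ltNge kv_mono ?blk_lt // -ltnNge.
Qed.

Lemma segS_blk (i : 'I_n) j : (j < tau n m)%N -> (i < seg j.+1)%N = (blk i <= j)%N.
Proof. by move=> jt; rewrite seg_ltS // -kv_blk kv_mono ?blk_lt. Qed.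

Lemma seg_le j : (j <= tau n m)%N -> (seg j <= n)%N.
Proof.
case: j => [|j] jt; first by rewrite seg0.
by rewrite (seg_card jt).2 -[X in (_ <= X)%N](card_ord n) max_card.
Qed.

Lemma seg_tau : seg (tau n m) = n.
Proof.
apply/eqP; rewrite eqn_leq seg_le //=; case E : (tau n m) => [|t].
  rewrite seg0 leqNgt; apply/negP => n0.
  by have := blk_lt (Ordinal n0); rewrite E.
rewrite leqNgt; apply/negP => lt; pose i := Ordinal lt.
have := @segS_blk i t; rewrite E /= ltnn => /(_ (leqnn _)) h.
by have := blk_lt i; rewrite E ltnS -h.
Qed.

(** The degree ranges [[seg j, seg j.+1]], where the successive relations of a hinge have nonzero
    [lambda], cover all degrees; consecutive ranges share an endpoint, where the normalization
    glues. *)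
Lemma seg_cover r : (0 < tau n m)%N -> (r <= n)%N ->
  exists j, [/\ (j < tau n m)%N, (seg j <= r)%N & (r <= seg j.+1)%N].
Proof.
case: r => [|r] t0 rn; first by exists 0%N; rewrite seg0.
pose i := Ordinal rn; exists (blk i); split; first exact: blk_lt.
  by rewrite leqW // leqNgt (@seg_blk i) ?blk_lt // ltnn.
by rewrite -[r]/(val i) (@segS_blk i) ?blk_lt.
Qed.

(** By [wt_topP] with [kappa] the [j]-th value, a set of top weight has all indices of larger value
    and none of smaller value. This is the support condition of [Dab], which links limits of
    one-parameter families to [lambda]. *)
Lemma top_seg j (S : {set 'I_n}) : (j < tau n m)%N ->
  (seg j <= #|S|)%N -> (#|S| <= seg j.+1)%N ->
  (wt m S == wt m (firsts n #|S|)) =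
  (firsts n (seg j) \subset S) && (S \subset firsts n (seg j.+1)).
Proof.
move=> jt lo hi.
have [] := @wt_topP n _ m S (kv j).
- by move=> i iS; rewrite -seg_ltS // (leq_trans iS hi).
- by move=> i iS; rewrite leNgt -seg_lt // -leqNgt (leq_trans lo iS).
move=> _ ->; apply/forallP/andP.
  move=> h; split; apply/subsetP => i; rewrite inE => iS.
    have := h i; rewrite (leq_trans iS lo); case: (i \in S) => //= /eqP mi.
    by rewrite seg_lt // mi ltxx in iS.
  have := h i; rewrite iS; case: (ltnP i #|S|) => [lt _|_ /= /eqP mi].
    exact: leq_trans lt hi.
  by rewrite seg_ltS // mi.
case=> /subsetP h1 /subsetP h2 i; apply/implyP => ne.
rewrite eq_le; apply/andP; split.
  rewrite leNgt -seg_lt //; apply: contra ne => lt; rewrite h1 ?inE //.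
  by rewrite (leq_trans lt lo).
rewrite -seg_ltS //; move: ne; have [iS _|iS] := boolP (i \in S).
  by have := h2 i iS; rewrite inE.
case: ltnP => // lt _; exact: leq_trans lt hi.
Qed.

End Blocks.

(** * Linear relations *)

Section Relations.
Variables (R : realType) (n : nat).
Local Notation C := R[i].
Local Notation lop := (lop R n).
Local Notation ImM := Defs.ImM.
Implicit Types (P Q : 'M[C]_(n, n + n)) (X Y : 'M[C]_n).

Definition headmx (b : nat) : 'M[C]_n := diag_mx (\row_(k < n) ((k < b)%N)%:R).
Definition tailmx (a : nat) : 'M[C]_n := diag_mx (\row_(k < n) ((a <= k)%N)%:R).

Lemma spanWE a b X Y : spanW a b X Y = row_mx (tailmx a *m X^T) (headmx (a + b) *m Y^T).
Proof. by []. Qed.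

Lemma head_tail a : tailmx a + headmx a = 1%:M.
Proof.
apply/matrixP => i j; rewrite !mxE; case: (eqVneq i j) => [->|_]; last by rewrite !mulr0n addr0.
by case: leqP; rewrite !mulr1n ?addr0 ?add0r.
Qed.

Lemma headM a b : (a <= b)%N -> headmx a *m headmx b = headmx a.
Proof.
move=> ab; rewrite mulmx_diag; congr diag_mx; apply/rowP => i; rewrite !mxE -natrM mulnb.
by case: ltnP => // ia; rewrite (leq_trans ia ab).
Qed.

Lemma headMr a b : (a <= b)%N -> headmx b *m headmx a = headmx a.
Proof. by move=> ab; rewrite diag_mxC headM. Qed.

Lemma tailM a b : (a <= b)%N -> tailmx b *m tailmx a = tailmx b.
Proof.
move=> ab; rewrite mulmx_diag; congr diag_mx; apply/rowP => i; rewrite !mxE -natrM mulnb.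
by case: (leqP b i) => // ib; rewrite (leq_trans ab ib).
Qed.

Lemma tailM_head a b : (b <= a)%N -> tailmx a *m headmx b = 0.
Proof.
move=> ab; rewrite mulmx_diag; apply/matrixP => i j; rewrite !mxE -natrM mulnb.
by case: (leqP a i) => /= ib; rewrite ?mul0rn // ltnNge (leq_trans ab ib) /= mul0rn.
Qed.

Lemma head_tailM a b : (a <= b)%N -> headmx a *m tailmx b = 0.
Proof. by move=> ab; rewrite diag_mxC tailM_head. Qed.

Lemma headmx_pid b : headmx b = pid_mx b.
Proof.
apply/matrixP => i j; rewrite !mxE -[i == j]val_eqE /=.
by case: (_ == _); rewrite ?mulr1n ?mulr0n. Qed.

Lemma rank_head b : (b <= n)%N -> \rank (headmx b) = b.
Proof. by move=> bn; rewrite headmx_pid rank_pid_mx. Qed.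

Lemma rank_tail a : (a <= n)%N -> \rank (tailmx a) = (n - a)%N.
Proof.
move=> an; have -> : tailmx a = copid_mx a by rewrite /copid_mx -headmx_pid -(head_tail a) addrK.
by rewrite rank_copid_mx.
Qed.

Lemma tail_0 : tailmx 0 = 1%:M.
Proof.
by rewrite -(head_tail 0) (_ : headmx 0 = 0) ?addr0 // headmx_pid pid_mx_0.
Qed.

Lemma lsubmx_sub m1 m2 (A : 'M[C]_(m1, n + n)) (B : 'M[C]_(m2, n + n)) :
  (A <= B)%MS -> (lsubmx A <= lsubmx B)%MS.
Proof.
case/submxP => W ->.
by rewrite -{1}(hsubmxK B) mul_mx_row row_mxKl submxMl.
Qed.

Lemma rsubmx_sub m1 m2 (A : 'M[C]_(m1, n + n)) (B : 'M[C]_(m2, n + n)) :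
  (A <= B)%MS -> (rsubmx A <= rsubmx B)%MS.
Proof.
case/submxP => W ->.
by rewrite -{1}(hsubmxK B) mul_mx_row row_mxKr submxMl.
Qed.

Section SubRelation.
Variables P Q : 'M[C]_(n, n + n).
Hypothesis PQ : (P <= Q)%MS.

Lemma DomM_sub : (DomM P <= DomM Q)%MS. Proof. exact: lsubmx_sub. Qed.

Lemma ImM_sub : (ImM P <= ImM Q)%MS. Proof. exact: rsubmx_sub. Qed.

Lemma KerM_sub : (KerM P <= KerM Q)%MS.
Proof.
have /submxP [W ->] := PQ; rewrite /KerM -(hsubmxK Q) mul_mx_row !row_mxKl !row_mxKr.
rewrite mulmxA submxMr //; apply/sub_kermxP.
by rewrite -mulmxA mulmx_ker.
Qed.

Lemma IndefM_sub : (IndefM P <= IndefM Q)%MS.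
Proof.
have /submxP [W ->] := PQ; rewrite /IndefM -(hsubmxK Q) mul_mx_row !row_mxKl !row_mxKr.
rewrite mulmxA submxMr //; apply/sub_kermxP.
by rewrite -mulmxA mulmx_ker.
Qed.

End SubRelation.

Lemma KerM_DomM P : (KerM P <= DomM P)%MS.
Proof. exact: submxMl. Qed.

Lemma IndefM_ImM P : (IndefM P <= ImM P)%MS.
Proof. exact: submxMl. Qed.

Lemma row_mx_ker P (u : 'rV[C]_n) : (u <= KerM P)%MS -> (row_mx u 0 <= P)%MS.
Proof.
case/submxP => W ->; rewrite -{2}(hsubmxK P).
apply/submxP; exists (W *m kermx (rsubmx P)).
by rewrite mul_mx_row -[W *m _ *m rsubmx P]mulmxA mulmx_ker mulmx0 /KerM mulmxA.
Qed.

Lemma row_mx_indef P (u : 'rV[C]_n) : (u <= IndefM P)%MS -> (row_mx 0 u <= P)%MS.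
Proof.
case/submxP => W ->; rewrite -{2}(hsubmxK P).
apply/submxP; exists (W *m kermx (lsubmx P)).
by rewrite mul_mx_row -[W *m _ *m lsubmx P]mulmxA mulmx_ker mulmx0 /IndefM mulmxA.
Qed.

Section SpanW.
Variables (a b : nat) (X Y : 'M[C]_n).
Hypotheses (Xu : X \in unitmx) (Yu : Y \in unitmx).
Local Notation W := (spanW a b X Y).

Lemma DomM_spanW : DomM W = tailmx a *m X^T.
Proof. by rewrite /DomM spanWE row_mxKl. Qed.

Lemma ImM_spanW : ImM W = headmx (a + b) *m Y^T.
Proof. by rewrite /Defs.ImM spanWE row_mxKr. Qed.

Lemma KerM_spanW : (KerM W == tailmx (a + b) *m X^T)%MS.
Proof.
rewrite /KerM spanWE row_mxKl row_mxKr; apply/andP; split.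
  set K := kermx _; have K0 : K *m headmx (a + b) = 0.
    have := mulmx_ker (headmx (a + b) *m Y^T); rewrite -/K mulmxA.
    move=> /(congr1 (mulmx^~ (invmx Y^T))).
    by rewrite mul0mx mulmxK // unitmx_tr.
  have -> : K = K *m tailmx (a + b).
    by rewrite -[LHS]mulmx1 -(head_tail (a + b)) mulmxDr K0 addr0.
  by rewrite mulmxA -[_ *m _ *m tailmx a]mulmxA tailM ?leq_addr // -mulmxA submxMl.
rewrite -(tailM (leq_addr b a)) -mulmxA submxMr //; apply/sub_kermxP.
by rewrite mulmxA tailM_head // mul0mx.
Qed.

Lemma IndefM_spanW : (IndefM W == headmx a *m Y^T)%MS.
Proof.
rewrite /IndefM spanWE row_mxKl row_mxKr; apply/andP; split.
  set K := kermx _; have K0 : K *m tailmx a = 0.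
    have := mulmx_ker (tailmx a *m X^T); rewrite -/K mulmxA.
    move=> /(congr1 (mulmx^~ (invmx X^T))).
    by rewrite mul0mx mulmxK // unitmx_tr.
  have -> : K = K *m headmx a.
    by rewrite -[LHS]mulmx1 -(head_tail a) mulmxDr K0 add0r.
  by rewrite mulmxA -[_ *m _ *m headmx (a + b)]mulmxA headM ?leq_addr // -mulmxA submxMl.
rewrite -(headM (leq_addr b a)) -mulmxA submxMr //; apply/sub_kermxP.
by rewrite mulmxA head_tailM // mul0mx.
Qed.

Lemma rank_spanW : \rank W = n.
Proof.
apply/eqP; apply/row_freeP.
exists (col_mx (invmx X^T *m tailmx a) (invmx Y^T *m headmx a)).
rewrite spanWE mul_row_col !mulmxA !mulmxK ?unitmx_tr //.
by rewrite tailM // headMr ?leq_addr // head_tail.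
Qed.

Lemma rankMtr (A Z : 'M[C]_n) : Z \in unitmx -> \rank (A *m Z^T) = \rank A.
Proof. by move=> Zu; rewrite mxrankMfree // row_free_unit unitmx_tr. Qed.

Hypothesis abn : (a + b <= n)%N.

Lemma rank_DomM : \rank (DomM W) = (n - a)%N.
Proof. by rewrite DomM_spanW rankMtr ?rank_tail // (leq_trans (leq_addr b a)). Qed.

Lemma rank_ImM : \rank (ImM W) = (a + b)%N.
Proof. by rewrite ImM_spanW rankMtr ?rank_head. Qed.

Lemma rank_IndefM : \rank (IndefM W) = a.
Proof.
by rewrite (eqmx_rank IndefM_spanW) rankMtr ?rank_head // (leq_trans (leq_addr b a)).
Qed.

Lemma rkRel_spanW : rkRel W = b.
Proof.
rewrite /rkRel rank_DomM (eqmx_rank KerM_spanW) rankMtr ?rank_tail //.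
by rewrite subnDA subKn // leq_subRL // (leq_trans (leq_addr b a)).
Qed.

End SpanW.

Section EqRelation.
Variables P Q : 'M[C]_(n, n + n).
Hypothesis PQ : (P == Q)%MS.

Lemma DomM_eq : (DomM P == DomM Q)%MS.
Proof. by case/andP: PQ => h1 h2; rewrite !DomM_sub. Qed.

Lemma ImM_eq : (ImM P == ImM Q)%MS.
Proof. by case/andP: PQ => h1 h2; rewrite !ImM_sub. Qed.

Lemma KerM_eq : (KerM P == KerM Q)%MS.
Proof. by case/andP: PQ => h1 h2; rewrite !KerM_sub. Qed.

Lemma IndefM_eq : (IndefM P == IndefM Q)%MS.
Proof. by case/andP: PQ => h1 h2; rewrite !IndefM_sub. Qed.

Lemma rkRel_eq : rkRel P = rkRel Q.
Proof. by rewrite /rkRel (eqmx_rank DomM_eq) (eqmx_rank KerM_eq). Qed.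

End EqRelation.

Lemma graphM_inj (A B : 'M[C]_n) : (graphM A == graphM B)%MS -> A = B.
Proof.
case/andP => /submxP [W]; rewrite /graphM mul_mx_row mulmx1 => /eq_row_mx [<-].
by rewrite mul1mx => /trmx_inj.
Qed.

Lemma spanW_graph b X Y : X \in unitmx ->
  (spanW 0 b X Y == graphM (Y *m headmx b *m invmx X))%MS.
Proof.
move=> Xu; have E : spanW 0 b X Y = X^T *m graphM (Y *m headmx b *m invmx X).
  rewrite spanWE tail_0 mul1mx /graphM mul_mx_row mulmx1 add0n !trmx_mul.
  by rewrite trmx_inv mulKVmx ?unitmx_tr // tr_diag_mx.
have Xu' : X^T \in unitmx by rewrite unitmx_tr.
by rewrite E; apply/andP; split; rewrite ?submxMl // -{1}(mulKmx Xu' (graphM _)) submxMl.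
Qed.

Lemma lam_head b : lam_cha (headmx b) = Dab R 0 b.
Proof.
rewrite lam_cha_diag DabE; congr dlop; apply/funext => S.
have -> /= : [set i : 'I_n | (i < 0)%N] \subset S by apply/subsetP => i; rewrite inE.
have [/subsetP h|/subsetPn [i iS]] := boolP (S \subset _).
  by rewrite big1 // => i /h; rewrite inE mxE add0n => ->.
by rewrite inE add0n => /negbTE ib; rewrite (bigD1 i) //= mxE ib mul0r.
Qed.

End Relations.

(** * Hinges *)

Section Conj.
Variables (R : realType) (n : nat).
Local Notation C := R[i].
Local Notation lop := (lop R n).
Implicit Types (X Y : 'M[C]_n) (d : {set 'I_n} -> C) (S T U : {set 'I_n}).

(** With [X] and [Y] fixed, [lambda] of every relation of a hinge and [L(P)] itself have this form,
    so identities between them reduce to identities between the functions [d]. *)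
Definition conj_lop X Y d : lop :=
  lop_mul (lam_cha Y) (lop_mul (dlop d) (lam_cha (invmx X))).

Definition ind (a b : nat) (S : {set 'I_n}) : C :=
  ((firsts n a \subset S) && (S \subset firsts n (a + b)))%:R.

(** The reference set has the size of [S]: for decreasing [m], the top weight is taken separately in
    each degree. *)
Definition etop (m : 'I_n -> int) (S : {set 'I_n}) : C :=
  (wt m S == wt m (firsts n #|S|))%:R.

Lemma lamXY_conj a b X Y : lamXY a b X Y = conj_lop X Y (ind a b).
Proof. by rewrite /lamXY DabE. Qed.

Lemma conj_lopE X Y d S T :
  conj_lop X Y d S T = \sum_U lam_cha Y S U * d U * lam_cha (invmx X) U T.
Proof.
by rewrite /conj_lop lop_mulE; apply: eq_bigr => U _; rewrite dlop_mull mulrA.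
Qed.

Lemma conj_lop_deg X Y d S T : #|S| != #|T| -> conj_lop X Y d S T = 0.
Proof.
move: S T; apply: lop_mul_deg; first exact: lam_neq.
by apply: lop_mul_deg; [exact: dlop_deg | exact: lam_neq].
Qed.

Lemma conj_lopZ X Y c d :
  (fun S T => c * conj_lop X Y d S T) = conj_lop X Y (fun U => c * d U).
Proof.
apply/lopEqP => S T; rewrite !conj_lopE mulr_sumr; apply: eq_bigr => U _.
by rewrite !mulrA; congr (_ * _); rewrite -!mulrA mulrCA.
Qed.

Lemma lrestr_conj r X Y d :
  lrestr r (conj_lop X Y d) = conj_lop X Y (fun U => if #|U| == r then d U else 0).
Proof.
apply/lopEqP => S T; rewrite /lrestr !conj_lopE.
have [/eqP Sr|Sr] /= := boolP (#|S| == r); last first.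
  rewrite big1 // => U _; case: eqP => Ur; last by rewrite mulr0 mul0r.
  by rewrite lam_neq ?mul0r // Ur.
have [/eqP Tr|Tr] := boolP (#|T| == r).
  apply: eq_bigr => U _; case: eqP => // Ur; rewrite lam_neq ?mul0r // Sr.
  by rewrite eq_sym; exact/eqP.
rewrite big1 // => U _; case: eqP => Ur; last by rewrite mulr0 mul0r.
by rewrite [lam_cha (invmx X) _ _]lam_neq ?mulr0 // Ur eq_sym.
Qed.

Lemma conj_inj X Y d d' : X \in unitmx -> Y \in unitmx ->
  conj_lop X Y d = conj_lop X Y d' -> d =1 d'.
Proof.
move=> Xu Yu E U; have : dlop d = dlop d'.
  have := congr1 (fun L => lop_mul (lop_mul (lam_cha (invmx Y)) L) (lam_cha X)) E.
  by rewrite /= /conj_lop !lop_mulA lam_chaVl // !lop_mul1l -!lop_mulA lam_chaVl // !lop_mul1r.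
by move/(congr1 (fun L => L U U)); rewrite /dlop eqxx.
Qed.

Lemma conj_head b X Y : X \in unitmx ->
  lam_cha (Y *m headmx R n b *m invmx X) = conj_lop X Y (ind 0 b).
Proof. by move=> Xu; rewrite !lam_chaM lam_head -lop_mulA -lamXY_conj. Qed.

Lemma isLambda_conj a b X Y (P : 'M[C]_(n, n + n)) : (a + b <= n)%N ->
  X \in unitmx -> Y \in unitmx -> (spanW a b X Y == P)%MS ->
  isLambda P (conj_lop X Y (ind a b)).
Proof.
move=> abn Xu Yu sP; exists 1, (lamXY a b X Y); split; first exact: oner_neq0.
split; first exact: lamXY_isLambdaRep.
by apply/lopEqP/lopEqP => S T; rewrite mul1r lamXY_conj.
Qed.

Lemma ind_firsts a b r : (a <= r)%N -> (r <= a + b)%N -> ind a b (firsts n r) = 1.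
Proof.
move=> ar rb; rewrite /ind; have -> : firsts n a \subset firsts n r.
  by apply/subsetP => i; rewrite !inE => /leq_trans; apply.
have -> // : firsts n r \subset firsts n (a + b).
by apply/subsetP => i; rewrite !inE => /leq_trans; apply.
Qed.

End Conj.

Section Hinges.
Variables (R : realType) (n : nat) (m : 'I_n -> int).
Hypothesis m_dec : forall i j : 'I_n, (i <= j)%N -> m j <= m i.
Local Notation C := R[i].
Local Notation al j := (alpha n m j).
Local Notation tau := (tau n m).
Local Notation ImM := Defs.ImM.
Implicit Types (P : nat -> 'M[C]_(n, n + n)) (L : nat -> lop R n) (X Y : 'M[C]_n).

Lemma ind_etop j (S : {set 'I_n}) : (j < tau)%N ->
  (seg m j <= #|S|)%N -> (#|S| <= seg m j.+1)%N -> ind R (seg m j) (al j) S = etop R m S.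
Proof. by move=> jt lo hi; rewrite /ind /etop (top_seg m_dec jt lo hi) segS. Qed.

Lemma ind_nz_card j r : (seg m j.+1 <= n)%N ->
  (exists2 S : {set 'I_n}, #|S| = r & ind R (seg m j) (al j) S != 0) ->
  (seg m j <= r)%N && (r <= seg m j.+1)%N.
Proof.
move=> sn [S <-]; rewrite /ind pnatr_eq0 eqb0 negbK -segS => /andP [h1 h2].
have := subset_leq_card h1; have := subset_leq_card h2.
rewrite !card_firsts //; first by move=> -> ->.
by rewrite (leq_trans _ sn) // segS leq_addr.
Qed.

(** Whichever [j] is chosen in a degree, nonvanishing forces the degree into the range of [j], and
    there [ind] coincides with [etop]. *)
Lemma etop_Lcal X Y L (Lc : lop R n) : X \in unitmx -> Y \in unitmx ->
  (forall j, (j < tau)%N -> L j = conj_lop X Y (ind R (seg m j) (al j))) ->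
  isLcal tau L Lc -> Lc = conj_lop X Y (etop R m).
Proof.
move=> Xu Yu LE [Lc0 Lcm]; apply/lopEqP => S T.
have [ST|ST] := eqVneq #|S| #|T|; last by rewrite Lc0 // conj_lop_deg.
have rn : (#|S| <= n)%N by rewrite -[X in (_ <= X)%N](card_ord n) max_card.
have [j [jt Lnz /lopEqP E]] := Lcm _ rn.
have := congr1 (fun M : lop R n => M S T) E.
rewrite [LHS]/lrestr [#|T| == _]eq_sym ST eqxx /= => ->.
rewrite LE // lrestr_conj.
have -> : conj_lop X Y (etop R m) S T = lrestr #|S| (conj_lop X Y (etop R m)) S T.
  by rewrite /lrestr ST eqxx.
rewrite -ST lrestr_conj; congr (conj_lop _ _ _ S T); apply/funext => U.
case: eqP => // Ur; have sn : (seg m j.+1 <= n)%N by exact: seg_le.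
have /andP [h1 h2] : (seg m j <= #|S|)%N && (#|S| <= seg m j.+1)%N.
  apply: ind_nz_card => //; case: Lnz => S' [T']; rewrite LE // lrestr_conj conj_lopE => nz.
  apply: contrapT => none; case/eqP: nz; apply: big1 => V _.
  case: eqP => Vr; last by rewrite mulr0 mul0r.
  have [->|iV] := eqVneq (ind R (seg m j) (al j) V) 0; first by rewrite mulr0 mul0r.
  by case: none; exists V.
by rewrite ind_etop ?Ur.
Qed.

Lemma conj_isLcal X Y L : (0 < tau)%N -> X \in unitmx -> Y \in unitmx ->
  (forall j, (j < tau)%N -> L j = conj_lop X Y (ind R (seg m j) (al j))) ->
  isLcal tau L (conj_lop X Y (etop R m)).
Proof.
move=> t0 Xu Yu LE; split; first exact: conj_lop_deg.
move=> r rn; have [j [jt lo hi]] := seg_cover m_dec t0 rn.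
exists j; split => //.
  rewrite LE // /lop_nz; apply: contrapT => none.
  have E : lrestr r (conj_lop X Y (ind R (seg m j) (al j))) = conj_lop X Y (fun=> 0).
    apply/lopEqP => S T; rewrite [RHS]conj_lopE big1; last by move=> U _; rewrite mulr0 mul0r.
    by apply/eqP/negPn/negP => nz; apply: none; exists S, T.
  rewrite lrestr_conj in E; have := conj_inj Xu Yu E (firsts n r).
  rewrite card_firsts // eqxx ind_firsts -?segS //; apply/eqP; exact: oner_neq0.
apply/lopEqP; rewrite LE // !lrestr_conj; congr (conj_lop _ _ _); apply/funext => U.
by case: eqP => // Ur; rewrite ind_etop ?Ur.
Qed.

(** All scalars are forced: [P 0] is the graph of only one operator, and in degree [seg m j.+1],
    shared by two consecutive relations, both symbols are 1 at the initial segment of that size. *)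
Lemma normalized_conj P L X Y : isHinge tau P -> X \in unitmx -> Y \in unitmx ->
  (forall j, (j < tau)%N -> (spanW (seg m j) (al j) X Y == P j)%MS) ->
  normalizedLambdas tau P L ->
  forall j, (j < tau)%N -> L j = conj_lop X Y (ind R (seg m j) (al j)).
Proof.
move=> [t0 [rP _ _ _ _]] Xu Yu sP [Ll [A [PA /lopEqP L0]] Ln].
have sn j : (j < tau)%N -> (seg m j + al j <= n)%N.
  by move=> jt; rewrite -segS seg_le.
elim=> [|j IH] jt.
  rewrite L0; have -> : A = Y *m headmx R n (al 0) *m invmx X.
    apply: graphM_inj; apply/eqmxP/(eqmx_trans (eqmx_sym (eqmxP PA))).
    apply: (eqmx_trans (eqmx_sym (eqmxP (sP 0%N jt)))); rewrite seg0.
    exact/eqmxP/spanW_graph.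
  by rewrite conj_head // seg0.
have [c c0] := isLambda_uniq (rP _ jt) Xu Yu (sP _ jt) (Ll _ jt).
rewrite lamXY_conj conj_lopZ => LE.
have jt' := ltnW jt; have := Ln j jt.
rewrite -(eqmx_rank (ImM_eq (sP j jt'))) rank_ImM ?sn // -segS.
move/lopEqP; rewrite LE IH // !lrestr_conj.
move=> /(conj_inj Xu Yu) /(_ (firsts n (seg m j.+1))).
rewrite card_firsts ?seg_le // eqxx !ind_firsts ?segS ?leq_addr // mulr1 => ->.
by congr (conj_lop _ _ _); apply/funext => U; rewrite mul1r.
Qed.

(** Any two bases cut into the blocks of [m] give a hinge: a kernel and the next domain are spanned
    by the same tail of [X], an image and the next indefiniteness by the same head of [Y]. *)
Lemma hinge_exists X Y : (0 < tau)%N -> X \in unitmx -> Y \in unitmx ->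
  exists P L, [/\ inO R n m P, normalizedLambdas tau P L &
    isLcal tau L (conj_lop X Y (etop R m))].
Proof.
move=> t0 Xu Yu; pose P j := spanW (seg m j) (al j) X Y.
pose L j := conj_lop X Y (ind R (seg m j) (al j)).
have sn j : (j < tau)%N -> (seg m j + al j <= n)%N.
  by move=> jt; rewrite -segS seg_le.
exists P, L; split; last exact: conj_isLcal.
  split; last by move=> j jt; rewrite rkRel_spanW ?sn.
  split=> //; split.
  - by move=> j _; rewrite rank_spanW.
  - move=> j jt; split.
      by rewrite /P DomM_spanW segS; exact: KerM_spanW.
    by rewrite /P ImM_spanW -segS; apply/eqmxP/eqmx_sym/eqmxP/IndefM_spanW.
  - by rewrite rank_DomM ?sn // seg0 subn0.
  - have jt : (tau.-1 < tau)%N by rewrite prednK.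
    by rewrite rank_ImM ?sn // -segS prednK // seg_tau.
  - by move=> j jt; rewrite rkRel_spanW ?sn // alpha_gt0.
split.
- by move=> j jt; apply: isLambda_conj; rewrite ?sn //; exact/eqmxP.
- exists (Y *m headmx R n (al 0) *m invmx X); split.
    by rewrite /P seg0 spanW_graph.
  by apply/lopEqP; rewrite conj_head // /L seg0.
(* In the shared degree [seg m j.+1] both symbols equal [etop]. *)
move=> j jt; have jt' := ltnW jt.
rewrite rank_ImM ?sn // -segS; apply/lopEqP; rewrite !lrestr_conj.
congr (conj_lop _ _ _); apply/funext => U; case: eqP => // Ur.
have ss : (seg m j <= seg m j.+1)%N by rewrite segS leq_addr.
have ss' : (seg m j.+1 <= seg m j.+2)%N by rewrite [X in (_ <= X)%N]segS leq_addr.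
by rewrite !ind_etop ?Ur.
Qed.

(* The bases of the separate relations can be glued: the i-th vectors are taken
   from the bases of the relation whose block contains i. *)
Lemma hinge_common_bases P : inO R n m P ->
  (forall j, (j < tau)%N -> exists M0, isLambdaRep (P j) M0) ->
  exists X Y, [/\ X \in unitmx, Y \in unitmx &
    forall j, (j < tau)%N -> (spanW (seg m j) (al j) X Y == P j)%MS].
Proof.
move=> [[t0 [rP PP rD rI _]] rk] rep.
have sn j : (j < tau)%N -> (seg m j + al j <= n)%N.
  by move=> jt; rewrite -segS seg_le.
have [B BP] : {B : nat -> 'M[C]_n * 'M[C]_n & forall j, (j < tau)%N ->
    exists a, exists b, [/\ (a + b <= n)%N, (B j).1 \in unitmx, (B j).2 \in unitmx &
      (spanW a b (B j).1 (B j).2 == P j)%MS]}.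
  apply: (@choice nat ('M[C]_n * 'M[C]_n)%type (fun j B => (j < tau)%N ->
    exists a, exists b, [/\ (a + b <= n)%N, B.1 \in unitmx, B.2 \in unitmx &
    (spanW a b B.1 B.2 == P j)%MS])) => j.
  have [jt|jt] := ltnP j tau; last by exists (1%:M, 1%:M).
  have [M0 /isLambdaRep_lamXY [a [b [X [Y [abn Xu Yu sP _]]]]]] := rep j jt.
  by exists (X, Y) => _; exists a, b.
pose Bs j := (B j).1; pose Bt j := (B j).2.
(* The parameters are forced by dimensions: [b] is the rank, and [a] is the dimension of [Indef],
   which equals that of the preceding image; for [P 0] the full domain gives [a = 0]. *)
have BW j : (j < tau)%N -> [/\ Bs j \in unitmx, Bt j \in unitmx &
    (spanW (seg m j) (al j) (Bs j) (Bt j) == P j)%MS].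
  elim: j => [|j IH] jt; have [a [b [abn Xu Yu sP]]] := BP _ jt; split=> //.
    have bE : b = al 0 by rewrite -(rk 0%N jt) -(rkRel_eq sP) rkRel_spanW.
    have := rD; rewrite -(eqmx_rank (DomM_eq sP)) rank_DomM // => naE.
    have an : (a <= n)%N := leq_trans (leq_addr b a) abn.
    have -> : seg m 0 = a.
      rewrite seg0; apply/eqP.
      by rewrite eq_sym -(eqn_add2l (n - a)) addn0 subnK // -{1}naE.
    by rewrite -bE.
  have [Xu' Yu' sP'] := IH (ltnW jt).
  have bE : b = al j.+1 by rewrite -(rk _ jt) -(rkRel_eq sP) rkRel_spanW.
  have aE : a = seg m j.+1.
    rewrite -(rank_IndefM Xu Yu abn) (eqmx_rank (IndefM_eq sP)).
    rewrite -(eqmx_rank (PP j jt).2) -(eqmx_rank (ImM_eq sP')) rank_ImM ?sn ?(ltnW jt) //.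
    by rewrite segS.
  by rewrite -bE -aE.
pose X := \matrix_(r < n, i < n) Bs (blk m i) r i.
pose Y := \matrix_(r < n, i < n) Bt (blk m i) r i.
have rX i : row i X^T = row i (Bs (blk m i))^T by apply/rowP => r; rewrite !mxE.
have rY i : row i Y^T = row i (Bt (blk m i))^T by apply/rowP => r; rewrite !mxE.
have rhead b i : row i (headmx R n b) = (i < b)%N%:R *: delta_mx 0 i.
  apply/rowP => k; rewrite !mxE eqxx /= [k == i]eq_sym.
  by case: (i == k); rewrite ?mulr1 ?mulr0 ?mulr1n ?mulr0n.
have rtail a i : row i (tailmx R n a) = (a <= i)%N%:R *: delta_mx 0 i.
  apply/rowP => k; rewrite !mxE eqxx /= [k == i]eq_sym.
  by case: (i == k); rewrite ?mulr1 ?mulr0 ?mulr1n ?mulr0n.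
have rheadM b i (A : 'M[C]_n) : row i (headmx R n b *m A) = (i < b)%N%:R *: row i A.
  by rewrite row_mul rhead -scalemxAl -rowE.
have rtailM a i (A : 'M[C]_n) : row i (tailmx R n a *m A) = (a <= i)%N%:R *: row i A.
  by rewrite row_mul rtail -scalemxAl -rowE.
(* In the relation of its own block an index belongs to a pair [g (+) G], so both components are
   present. *)
have mid i : (row_mx (row i X^T) (row i Y^T) <= P (blk m i))%MS.
  have jt := blk_lt m i; have [_ _ sP] := BW _ jt; rewrite -(eqmxP sP).
  apply/submxP; exists (delta_mx 0 i); rewrite -rowE spanWE row_row_mx.
  rewrite rtailM rheadM -rX -rY -segS.
  by rewrite leqNgt (seg_blk m_dec) // (segS_blk m_dec) // ltnn leqnn !scale1r.
have domX i : (row i X^T <= DomM (P (blk m i)))%MS.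
  by have := lsubmx_sub (mid i); rewrite row_mxKl.
have imY i : (row i Y^T <= ImM (P (blk m i)))%MS.
  by have := rsubmx_sub (mid i); rewrite row_mxKr.
have domD j j' : (j <= j')%N -> (j' < tau)%N -> (DomM (P j') <= DomM (P j))%MS.
  elim: j' => [|j' IH]; first by rewrite leqn0 => /eqP ->.
  rewrite leq_eqVlt => /orP [/eqP -> //|jj'] jt.
  apply: submx_trans (IH jj' (ltnW jt)).
  by rewrite -(eqmxP (PP j' jt).1) KerM_DomM.
have imD j j' : (j <= j')%N -> (j' < tau)%N -> (ImM (P j) <= ImM (P j'))%MS.
  elim: j' => [|j' IH]; first by rewrite leqn0 => /eqP ->.
  rewrite leq_eqVlt => /orP [/eqP -> //|jj'] jt.
  apply: submx_trans (IH jj' (ltnW jt)) _.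
  by rewrite (eqmxP (PP j' jt).2) IndefM_ImM.
(* Descending induction: the vectors of block [j] are columns of [X], and the later ones span the
   kernel of [P j], which is the domain of [P j.+1]. At [j = 0] this makes [X] invertible. *)
have Xspan j : (j < tau)%N -> (DomM (P j) <= X^T)%MS.
  have [k] := ubnP (tau - j)%N; elim: k j => // k IH j kj jt.
  have [Xu Yu sP] := BW j jt; rewrite -(eqmxP (DomM_eq sP)) DomM_spanW.
  apply/row_subP => i; rewrite rtailM; have [ji|_] := leqP; last by rewrite scale0r sub0mx.
  rewrite scale1r; have [ij|ij] := ltnP i (seg m j.+1).
    have E : blk m i = j.
      apply/eqP; rewrite eqn_leq -(segS_blk m_dec) // ij leqNgt -(seg_blk m_dec) //.
      by rewrite -leqNgt.
    by rewrite -[X in Bs X]E -rX row_sub.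
  have jt' : (j.+1 < tau)%N.
    rewrite ltn_neqAle jt andbT; apply/negP => /eqP E.
    by move: ij; rewrite E seg_tau // leqNgt ltn_ord.
  apply: submx_trans (IH j.+1 _ jt'); last first.
    by rewrite subnSK // -ltnS.
  rewrite -(eqmxP (PP j jt').1) -(eqmxP (KerM_eq sP)) (eqmxP (KerM_spanW _ _ _ Yu)).
  rewrite -segS; apply: submx_trans (row_sub i _).
  by rewrite rtailM ij scale1r.
have Yspan j : (j < tau)%N -> (ImM (P j) <= Y^T)%MS.
  elim: j => [|j IH] jt; have [Xu Yu sP] := BW _ jt;
    rewrite -(eqmxP (ImM_eq sP)) ImM_spanW -segS; apply/row_subP => i; rewrite rheadM;
    (have [ij|_] := ltnP; last by rewrite scale0r sub0mx); rewrite scale1r.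
    have E : blk m i = 0%N.
      by apply/eqP; rewrite -leqn0 -(segS_blk m_dec).
    by rewrite -[X in Bt X]E -rY row_sub.
  have [ij'|ij'] := ltnP i (seg m j.+1); last first.
    have E : blk m i = j.+1.
      apply/eqP; rewrite eqn_leq -(segS_blk m_dec) // ij leqNgt -(seg_blk m_dec) //.
      by rewrite -leqNgt.
    by rewrite -[X in Bt X]E -rY row_sub.
  apply: submx_trans (IH (ltnW jt)).
  rewrite (eqmxP (PP j jt).2) -(eqmxP (IndefM_eq sP)) (eqmxP (IndefM_spanW _ _ _ Xu)).
  apply: submx_trans (row_sub i _).
  by rewrite rheadM ij' scale1r.
have Xu : X \in unitmx.
  rewrite -unitmx_tr -row_full_unit -col_leq_rank.
  by apply: leq_trans (mxrankS (Xspan 0%N t0)); rewrite rD.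
have jt : (tau.-1 < tau)%N by rewrite prednK.
have Yu : Y \in unitmx.
  rewrite -unitmx_tr -row_full_unit -col_leq_rank.
  by apply: leq_trans (mxrankS (Yspan _ jt)); rewrite rI.
exists X, Y; split=> // j {}jt.
(* Inclusion suffices since both sides have rank [n]. Indices of earlier blocks lie in [Indef]
   because the images increase, those of later blocks in the kernel because the domains decrease. *)
have sub : (spanW (seg m j) (al j) X Y <= P j)%MS.
  apply/row_subP => i; rewrite spanWE row_row_mx rtailM rheadM -segS.
  rewrite leqNgt (seg_blk m_dec) // (segS_blk m_dec) //.
  case: (ltngtP (blk m i) j) => [lt|gt|E] /=.
  - rewrite scale0r scale1r; apply: row_mx_indef.
    case: j jt lt => // j jt; rewrite ltnS => lt.
    by rewrite -(eqmxP (PP j jt).2); apply: submx_trans (imY i) (imD _ _ lt (ltnW jt)).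
  - rewrite scale0r scale1r; apply: row_mx_ker.
    have jt' : (j.+1 < tau)%N by exact: leq_ltn_trans gt (blk_lt m i).
    by rewrite (eqmxP (PP j jt').1); apply: submx_trans (domX i) (domD _ _ gt (blk_lt m i)).
  - by rewrite !scale1r -E mid.
by have := (mxrank_leqif_eq sub).2; rewrite rank_spanW // rP // eqxx => <-.
Qed.

Lemma hinge_Lcal P L (Lc : lop R n) : inO R n m P -> normalizedLambdas tau P L ->
  isLcal tau L Lc -> exists X Y, [/\ X \in unitmx, Y \in unitmx &
    Lc = conj_lop X Y (etop R m)].
Proof.
move=> PO LN LL; have rep j : (j < tau)%N -> exists M0, isLambdaRep (P j) M0.
  by case: LN => Ll _ _ /Ll [c [M0 [_ [h _]]]]; exists M0.
have [X [Y [Xu Yu sP]]] := hinge_common_bases PO rep.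
exists X, Y; split=> //; apply: (etop_Lcal Xu Yu _ LL).
by case: PO => PH _; apply: (normalized_conj PH Xu Yu sP LN).
Qed.

End Hinges.

(** * Spike points are limits *)

Section TupleDiagonal.
Variables (R : realType) (n : nat) (nu : 'I_n -> nat).
Local Notation C := R[i].
Implicit Types (x : tvec R nu) (S T : tidx nu) (D : tidx nu -> C) (Y V : 'M[C]_n).

(** The diagonal [D] is a function of the whole tuple, not a product over factors: limits are taken
    of diagonals that are rescaled and cut off outside the graded indices. *)
Definition tdiag Y V D x : tvec R nu := fun S =>
  \sum_(T : tidx nu) (\prod_(i < Nsig nu) lam_cha Y (S i) (T i)) * (D T * rT (lam_cha V) x T).

Lemma rT_tdiag Y V (d : {set 'I_n} -> C) x :
  rT (lop_mul (lam_cha Y) (lop_mul (dlop d) (lam_cha V))) x =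
  tdiag Y V (fun T => \prod_(i < Nsig nu) d (T i)) x.
Proof.
rewrite !rT_mul; apply/funext => S; apply: eq_bigr => T _.
by rewrite rT_dlop.
Qed.

Lemma eq_tdiag Y V D D' x : graded_vec x -> (forall T, graded T -> D T = D' T) ->
  tdiag Y V D x = tdiag Y V D' x.
Proof.
move=> xg DD; apply/funext => S; apply: eq_bigr => T _; congr (_ * _).
have [gT|gT] := boolP (graded T); first by rewrite DD.
by rewrite (rT_graded (@lam_neq R n V) xg gT) !mulr0.
Qed.

Lemma tdiagZ Y V c D x S : tdiag Y V (fun T => c * D T) x S = c * tdiag Y V D x S.
Proof.
by rewrite mulr_sumr; apply: eq_bigr => T _; rewrite -mulrA mulrCA.
Qed.

Lemma tends_tdiag (F : set_system nat) {FF : Filter F} (Yk Vk : nat -> 'M[C]_n) Y V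
    (Dk : nat -> tidx nu -> C) D x S :
  (forall i j, tends F (fun k => Yk k i j) (Y i j)) ->
  (forall i j, tends F (fun k => Vk k i j) (V i j)) ->
  (forall T, tends F (fun k => Dk k T) (D T)) ->
  tends F (fun k => tdiag (Yk k) (Vk k) (Dk k) x S) (tdiag Y V D x S).
Proof.
have lam (Ak : nat -> 'M[C]_n) (A : 'M[C]_n) : (forall i j, tends F (fun k => Ak k i j) (A i j)) ->
    forall P Q, tends F (fun k => lam_cha (Ak k) P Q) (lam_cha A P Q).
  move=> hA P Q; rewrite /lam_cha /minor; case: ifP => _; last exact: tends_cst.
  apply: tends_det => i j; rewrite mxE.
  by apply: tends_ext (hA (enum_val i) (nth (enum_val j) (enum Q) j)) => k; rewrite mxE.
move=> hY hV hD; apply: tends_sum => T _; apply: tendsM.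
  by apply: tends_prod => i _; exact: lam.
apply: tendsM => //; apply: tends_sum => T' _; apply: tendsM; last exact: tends_cst.
by apply: tends_prod => i _; exact: lam.
Qed.

End TupleDiagonal.

Lemma prod_exprz (K : fieldType) (I : finType) (P : pred I) (t : K) (m : I -> int) :
  t != 0 -> \prod_(i | P i) t ^ m i = t ^ (\sum_(i | P i) m i).
Proof.
move=> t0; apply/esym.
by apply: (big_morph (fun e : int => t ^ e) (fun a b => expfzDr a b t0) (expr0z t)).
Qed.

Lemma tends_exprz (R : realType) (e : int) : e <= 0 ->
  tends eventually (fun k => ((k.+1)%:R : R[i]) ^ e) (e == 0)%:R.
Proof.
move=> e0; have [->|ne] := eqVneq e 0.
  by apply: tends_ext (tends_cst 1) => k; rewrite expr0z.
have [p ->] : exists p : nat, e = - p.+1%:Z.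
  by case: e e0 ne => [[|p]|p] // _ _; exists p; rewrite NegzE.
move=> eps eps0; have [N hN] : exists N : nat, eps^-1 < N.+1%:R.
  case: eps eps0 => a b; rewrite ltcE /= => /andP [/eqP -> a0].
  have [N aN] : exists N : nat, a^-1 < N%:R
    by exists (Num.bound a^-1); rewrite archi_boundP // invr_ge0 ltW.
  exists N; have -> : (a +i* 0)%C = (a%:C)%C :> R[i] by [].
  rewrite -fmorphV -(rmorph_nat (real_complex R)) ltcR (lt_le_trans aN) //.
  by rewrite ler_nat.
exists N => // k /= Nk; rewrite subr0 -exprnN normfV normrX normr_nat.
have k1 : 1 <= k.+1%:R :> R[i] by rewrite ler1n.
rewrite invf_plt ?posrE ?exprn_gt0 ?ltr0n //.
apply: (lt_le_trans hN); apply: le_trans (_ : k.+1%:R <= _); first by rewrite ler_nat.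
by rewrite ler_eXnr.
Qed.

Section ImageInClosure.
Variables (R : realType) (n sigma : nat) (nus : 'I_sigma -> 'I_n -> nat).
Hypothesis nus_sig : forall l, isSignature (nus l).
Local Notation C := R[i].

Lemma vl_top (m : 'I_n -> int) l : vl n sigma nus m l = twt m (top_idx (nus l)).
Proof.
rewrite twt_top //; apply: eq_bigr => i _.
by rewrite -[RHS]mulr_natr natz.
Qed.

(** With [t = k + 1], a graded index [T] is scaled by [t ^ (twt m T - v)], whose exponent is
    nonpositive; only the weights equal to [v] survive. *)
Lemma spike_limit (X Y : 'M[C]_n) (m : 'I_n -> int) (v : int) (z : Zvec R n sigma nus)
    (l : 'I_sigma) S :
  X \in unitmx -> Y \in unitmx ->
  (forall i j : 'I_n, (i <= j)%N -> m j <= m i) ->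
  (forall l, vl n sigma nus m l <= v) -> inZ R n sigma nus z ->
  tends eventually (fun k => (k.+1%:R : C) ^ (- v) * zetaG R n sigma nus
      (Y *m diag_mx (\row_i (k.+1%:R : C) ^ m i) *m invmx X) z l S)
    (zetaSpike R n sigma nus m (conj_lop X Y (etop R m)) v z l S).
Proof.
move=> Xu Yu mdec mv zZ; have zg := inH_graded (zZ l).
(* Weights of non-graded indices may exceed [v]; cutting them off does not affect the graded vector
   [z l]. *)
pose D (T : tidx (nus l)) : C := if graded T then (twt m T - v == 0)%:R else 0.
pose Dk k (T : tidx (nus l)) : C := if graded T then k.+1%:R ^ (twt m T - v) else 0.
have topv (T : tidx (nus l)) : graded T -> twt m T <= v.
  move=> gT; apply: le_trans (twt_top_le mdec gT).1 _.
  by rewrite -vl_top.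
have lim : tends eventually (fun k => tdiag Y (invmx X) (Dk k) (z l) S)
    (tdiag Y (invmx X) D (z l) S).
  apply: tends_tdiag => [i j|i j|T]; try exact: tends_cst.
  rewrite /Dk /D; case: ifP => gT; last exact: tends_cst.
  by apply: tends_exprz; rewrite subr_le0 topv.
have -> : zetaSpike R n sigma nus m (conj_lop X Y (etop R m)) v z l S =
    tdiag Y (invmx X) D (z l) S.
  rewrite /zetaSpike /zetaOp; have [/eqP vlv|vlv] := boolP (vl n sigma nus m l == v).
    rewrite rT_tdiag; congr (_ S); apply: eq_tdiag => // T gT.
    rewrite /D gT subr_eq0 -vlv vl_top (twt_top_le mdec gT).2.
    have [/forallP h|/forallPn [i h]] := boolP [forall i, wt m (T i) == wt m (firsts n #|T i|)].
      by rewrite big1 // => i _; rewrite /etop h.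
    by rewrite (bigD1 i) //= /etop (negbTE h) mul0r.
  (* A summand whose highest weight is below [v] has no surviving weight. *)
  rewrite (_ : tdiag _ _ D _ = tdiag Y (invmx X) (fun=> 0) (z l)); last first.
    apply: eq_tdiag => // T gT; rewrite /D gT subr_eq0 lt_eqF //.
    apply: le_lt_trans (twt_top_le mdec gT).1 _.
    by rewrite -vl_top lt_neqAle vlv mv.
  by rewrite /tdiag big1 // => T _; rewrite mul0r mulr0.
apply: tends_ext lim => k; rewrite /zetaG /zetaOp !lam_chaM lam_cha_diag -lop_mulA.
have k0 : (k.+1%:R : C) != 0 by rewrite pnatr_eq0.
rewrite rT_tdiag -tdiagZ; congr (_ S); apply: eq_tdiag => // T gT.
rewrite /Dk gT addrC expfzDr //; congr (_ * _); rewrite /twt -prod_exprz //.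
apply: eq_bigr => i _; rewrite /wt -prod_exprz //; apply: eq_bigr => j _.
by rewrite mxE.
Qed.

Lemma image_in_closure (B : Zop R n sigma nus) :
  inImage R n sigma nus B -> inClosure R n sigma nus B.
Proof.
case=> [[g [gu [Bnz [c [c0 gB]]]]]|
    [m [P [L [Lc [v [[mdec _] [PO LN LL [_ mv] [Bnz [c [c0 XB]]]]]]]]]]].
  split=> //; exists (fun=> c^-1), (fun=> g); split=> // z zZ l S.
  apply/cvgC_tends; rewrite gB // mulKf //; exact: tends_cst.
have [X [Y [Xu Yu LcE]]] := hinge_Lcal mdec PO LN LL.
split=> //; exists (fun k => c^-1 * (k.+1%:R : C) ^ (- v)).
exists (fun k => Y *m diag_mx (\row_i (k.+1%:R : C) ^ m i) *m invmx X); split.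
  move=> k; rewrite !unitmx_mul Yu unitmx_inv Xu andbT /= unitmxE det_diag unitfE.
  by apply/prodf_neq0 => i _; rewrite mxE expfz_neq0 // pnatr_eq0.
move=> z zZ l S; apply/cvgC_tends.
have -> : B z l S = c^-1 * zetaSpike R n sigma nus m (conj_lop X Y (etop R m)) v z l S.
  by rewrite -LcE XB // mulKf.
apply: (tends_ext (u := fun k => c^-1 * ((k.+1%:R : C) ^ (- v) * zetaG R n sigma nus
      (Y *m diag_mx (\row_i (k.+1%:R : C) ^ m i) *m invmx X) z l S))).
  by move=> k; rewrite mulrA.
by apply: tendsM; [exact: tends_cst | exact: spike_limit].
Qed.

End ImageInClosure.

(** * Limits are spike points *)

(** Clear denominators, then divide by the gcd. The zero vector has no primitive multiple and is
    kept as the case that leads back to [GL_n]. *)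
Lemma primitive_multiple n (q : 'I_n -> rat) :
  exists (m : 'I_n -> int) (c : rat), [/\ 0 < c, forall i, (m i)%:~R = c * q i &
    (forall i, m i = 0) \/ \big[gcdn/0%N]_(i : 'I_n) `|m i|%N = 1%N].
Proof.
pose D : int := \prod_i denq (q i).
pose m' i : int := numq (q i) * \prod_(j | j != i) denq (q j).
have D0 : 0 < D by apply: prodr_gt0 => i _; exact: denq_gt0.
have m'E i : (m' i)%:~R = D%:~R * q i :> rat.
  have dn : (denq (q i))%:~R != 0 :> rat by rewrite intr_eq0 denq_neq0.
  apply: (mulIf dn); rewrite -mulrA -numqE -!intrM; congr _%:~R.
  by rewrite /m' /D [in RHS](bigD1 i) //=; ring.
have [m0|/existsNP [i0 /eqP i0nz]] := pselect (forall i, m' i = 0).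
  by exists m', D%:~R; split=> //; [rewrite ltr0z | left].
pose G := \big[gcdn/0%N]_(i : 'I_n) `|m' i|%N.
have G_dvd i : (G %| `|m' i|)%N by exact: (@biggcdn_inf _ i).
have G0 : (0 < G)%N.
  by rewrite lt0n; apply: contra i0nz => /eqP G0; have := G_dvd i0; rewrite G0 dvd0n absz_eq0.
pose m i : int := (m' i %/ G%:Z)%Z.
have mE i : m i * G%:Z = m' i by rewrite divzK // dvdzE.
have GQ : (G%:Z)%:~R != 0 :> rat by rewrite intr_eq0 -lt0n.
exists m, (D%:~R / (G%:Z)%:~R); split.
- by rewrite divr_gt0 // ltr0z.
- by move=> i; apply: (mulIf GQ); rewrite -rmorphM /= mE m'E mulrAC divfK.
right; set h := \big[_/_]_i _; have hG : (h * G %| G)%N.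
  apply/dvdn_biggcdP => i _; rewrite -(mE i) abszM dvdn_mul //.
  exact: (@biggcdn_inf _ i).
by apply/eqP; rewrite -dvdn1 -(dvdn_pmul2r G0) mul1n.
Qed.

Lemma tends_le0_bounded (R : realType) (U : set_system nat) {UU : UltraFilter U}
    (e : nat -> R) M : U (fun k => e k <= 0) -> U (fun k => - M <= e k) ->
  exists b, tends U e b.
Proof.
move=> e0 eM; apply: (@ultra_bounded _ _ _ _ `|M|); apply: filterS2 e0 eM => k h1 h2.
rewrite ler0_norm // lerNl (le_trans _ h2) // lerN2.
exact: ler_norm.
Qed.

(** Turns nonvanishing of a limit coefficient into a lower bound on the exponent, the form in which
    it defines a cone. *)
Lemma expR_tends0P (R : realType) (U : set_system nat) {UU : UltraFilter U}
    (e : nat -> R) del : tends U (fun k => expR (e k)) del ->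
  (exists M, U (fun k => - M <= e k)) <-> del != 0.
Proof.
move=> lim; split=> [[M eM]|dnz].
  apply/eqP => d0; have [k [h1 h2]] := filter_ex (filterI eM (lim _ (expR_gt0 (- M)))).
  move: h2; rewrite d0 subr0 ger0_norm ?expR_ge0 // ltr_expR.
  by rewrite ltNge h1.
have d2 : 0 < `|del| / 2 by rewrite divr_gt0 // normr_gt0.
(* On a set of [U] the exponential is at least half of its limit. *)
exists (- ln (`|del| / 2)); apply: filterS (lim _ d2) => k hk.
rewrite opprK -ler_expR lnK ?posrE //.
rewrite distrC in hk; have := lerB_dist del (expR (e k)).
rewrite [`|expR _|]ger0_norm ?expR_ge0 //.
by lra.
Qed.

(** A row space is closed: [pinvmx M *m M] fixes every [x k *m M], hence their limit, even when [x]
    itself diverges. *)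
Lemma tends_row_space (R : realType) (U : set_system nat) {UU : UltraFilter U} n p
    (x : nat -> 'rV[R]_n) (M : 'M[R]_(n, p)) (b : 'rV[R]_p) :
  (forall j, tends U (fun k => (x k *m M) 0 j) (b 0 j)) -> b *m pinvmx M *m M = b.
Proof.
move=> lim; apply/rowP => j.
have h : tends U (fun k => (x k *m M *m (pinvmx M *m M)) 0 j) ((b *m (pinvmx M *m M)) 0 j).
  apply: tends_mulmx => [i l|i l]; last exact: tends_cst.
  by rewrite ord1; exact: lim.
rewrite -mulmxA; apply: (tends_uniq h).
apply: tends_ext (lim j) => k.
by rewrite mulmxA mulmxKpV // submxMl.
Qed.

(** * Asymptotics of the exponents along an ultrafilter *)

Section ClosureInImage.
Variables (R : realType) (n sigma : nat) (nus : 'I_sigma -> 'I_n -> nat).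
Hypothesis nus_sig : forall l, isSignature (nus l).
Local Notation C := R[i].
Local Open Scope complex_scope.

Definition expdiag (y : 'rV[R]_n) : 'M[C]_n := real_diag (map_mx (@expR R) y).

Lemma lam_expdiag (y : 'rV[R]_n) :
  lam_cha (expdiag y) = dlop (fun S => (expR (wt (fun i => y 0 i) S))%:C).
Proof.
rewrite /expdiag /real_diag lam_cha_diag; congr dlop; apply/funext => S.
rewrite /wt expR_sum rmorph_prod; apply: eq_bigr => i _.
by rewrite !mxE.
Qed.

Lemma prod_expdiag (y : 'rV[R]_n) (nu : 'I_n -> nat) (T : tidx nu) :
  \prod_(i < Nsig nu) (expR (wt (fun j => y 0 j) (T i)))%:C =
  (expR (twt (fun j => y 0 j) T))%:C :> C.
Proof. by rewrite /twt expR_sum rmorph_prod. Qed.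

Lemma zetaG_expdiag (Y V : 'M[C]_n) (y : 'rV[R]_n) z l :
  zetaG R n sigma nus (Y *m expdiag y *m V) z l =
  tdiag Y V (fun T => (expR (twt (fun j => y 0 j) T))%:C) (z l).
Proof.
rewrite /zetaG /zetaOp !lam_chaM -lop_mulA lam_expdiag rT_tdiag.
by congr (tdiag _ _ _ _); apply/funext => T; rewrite prod_expdiag.
Qed.

Definition pairT : finType := {l : 'I_sigma & tidx (nus l)}.

Section Limit.
Variables (U : set_system nat) (UU : UltraFilter U).
Variables (x : nat -> 'rV[R]_n) (l0 : 'I_sigma).
Hypothesis x_dec : forall k (i j : 'I_n), (i <= j)%N -> x k 0 j <= x k 0 i.
Let tw (y : 'rV[R]_n) (l : 'I_sigma) (T : tidx (nus l)) : R := twt (fun j => y 0 j) T.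
Let top l : tidx (nus l) := top_idx (nus l).
Hypothesis l0_max : U (fun k => forall l, tw (x k) (top l) <= tw (x k) (top l0)).
Let ex l (T : tidx (nus l)) k : R := tw (x k) T - tw (x k) (top l0).

Lemma ex_le0 l (T : tidx (nus l)) : graded T -> U (fun k => ex T k <= 0).
Proof.
move=> gT; apply: filterS l0_max => k h; rewrite subr_le0.
by apply: le_trans (h l); exact: (twt_top_le (x_dec k) gT).1.
Qed.

(** Coefficients of the weight of [T] relative to the dominant highest weight; the ring varies
    because they are paired with integer, rational and real vectors. *)
Let cf (V : pzRingType) l (T : tidx (nus l)) (j : 'I_n) : V :=
  #|[set i | j \in T i]|%:R - (nus l0 j)%:R.

Lemma twt_cf (V : comPzRingType) (d : 'I_n -> V) l (T : tidx (nus l)) :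
  twt d T - twt d (top l0) = \sum_j cf V T j * d j.
Proof.
rewrite twt_count twt_top // -sumrB; apply: eq_bigr => j _.
by rewrite /cf mulrBl !mulr_natl.
Qed.

(* The asymptotic directions of x are replaced by one integer vector m with the
   same dominant weights, and its bounded part by one real vector y. *)
Lemma tropical_limit (del : forall l, tidx (nus l) -> R) :
  (forall l (T : tidx (nus l)), graded T -> tends U (fun k => expR (ex T k)) (del l T)) ->
  exists (m : 'I_n -> int) (y : 'rV[R]_n),
  [/\ forall i j : 'I_n, (i <= j)%N -> m j <= m i,
      (forall i, m i = 0) \/ \big[gcdn/0%N]_(i : 'I_n) `|m i|%N = 1%N,
      forall l (T : tidx (nus l)), graded T -> twt m T <= twt m (top l0) &
      forall l (T : tidx (nus l)), graded T ->
        del l T = if twt m T == twt m (top l0) then expR (tw y T - tw y (top l0)) else 0].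
Proof.
move=> lim.
pose dot (a : 'rV[rat]_n) k : R := \sum_j ratr (a 0 j) * x k 0 j.
(* The preorder is total because [U] decides the sign of [dot a]. A graded weight survives in the
   limit exactly when its difference from the dominant one lies in [Q]. *)
pose Q (a : 'rV[rat]_n) := exists M, U (fun k => - M <= dot a k).
pose a l (T : tidx (nus l)) : 'rV[rat]_n := \row_j cf rat T j.
pose e (p : 'I_n * 'I_n) : 'rV[rat]_n := delta_mx 0 p.1 - delta_mx 0 p.2.
have dotD b c k : dot (b + c) k = dot b k + dot c k.
  by rewrite /dot -big_split; apply: eq_bigr => j _; rewrite mxE rmorphD mulrDl.
have dotZ q b k : dot (q *: b) k = ratr q * dot b k.
  by rewrite /dot mulr_sumr; apply: eq_bigr => j _; rewrite mxE rmorphM mulrA.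
have dotN b k : dot (- b) k = - dot b k.
  by rewrite -scaleN1r dotZ rmorphN1 mulN1r.
have dota l (T : tidx (nus l)) k : dot (a l T) k = ex T k.
  rewrite /ex /tw twt_cf; apply: eq_bigr => j _.
  by rewrite mxE /cf rmorphB !rmorph_nat.
have dote i j k : dot (e (i, j)) k = x k 0 i - x k 0 j.
  have dd l : dot (delta_mx 0 l) k = x k 0 l.
    rewrite /dot (bigD1 l) //= mxE !eqxx rmorph1 mul1r big1 ?addr0 // => l' ll'.
    by rewrite mxE (negbTE ll') andbF rmorph0 mul0r.
  by rewrite /e dotD dotN !dd.
have QD b c : Q b -> Q c -> Q (b + c).
  case=> [M hM] [M' hM']; exists (M + M'); apply: filterS2 hM hM' => k h h'.
  by rewrite dotD opprD lerD.
have QZ q b : 0 <= q -> Q b -> Q (q *: b).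
  move=> q0 [M hM]; exists (ratr q * M); apply: filterS hM => k h.
  by rewrite dotZ -mulrN ler_wpM2l // ler0q.
have Qt b : Q b \/ Q (- b).
  have [h|h] := in_ultra_setVsetC (fun k => 0 <= dot b k) UU.
    by left; exists 0; apply: filterS h => k; rewrite oppr0.
  right; exists 0; apply: filterS h => k /negP; rewrite -ltNge => h.
  by rewrite dotN oppr0 oppr_ge0 ltW.
(* The weight differences and their opposites let [m] detect both inequalities; the vectors [e] make
   [m] decreasing. *)
pose s := [seq a (tag p) (tagged p) | p : pairT] ++
  [seq - a (tag p) (tagged p) | p : pairT] ++ [seq e p | p : 'I_n * 'I_n].
have [mq mqP] := total_cone_realizable s QD QZ Qt.
have [m [c [c0 mE mgcd]]] := primitive_multiple (fun i => mq i 0).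
have dotm (b : 'rV[rat]_n) : c * (b *m mq) 0 0 = \sum_j b 0 j * (m j)%:~R.
  by rewrite mxE mulr_sumr; apply: eq_bigr => j _; rewrite mE mulrCA.
have sa l (T : tidx (nus l)) : a l T \in s.
  rewrite mem_cat; apply/orP; left; apply/mapP.
  by exists (Tagged (fun l => tidx (nus l)) T); rewrite ?mem_enum.
have sNa l (T : tidx (nus l)) : - a l T \in s.
  rewrite !mem_cat; apply/orP; right; apply/orP; left; apply/mapP.
  by exists (Tagged (fun l => tidx (nus l)) T); rewrite ?mem_enum.
have se p : e p \in s.
  by rewrite !mem_cat; apply/orP; right; apply/orP; right; apply/mapP; exists p; rewrite ?mem_enum.
have dotma l (T : tidx (nus l)) :
    c * (a l T *m mq) 0 0 = (twt m T - twt m (top l0))%:~R.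
  rewrite dotm twt_cf rmorph_sum; apply: eq_bigr => j _.
  by rewrite mxE rmorphM /= /cf !rmorphB /= !rmorph_nat.
have Qa l (T : tidx (nus l)) : Q (a l T) <-> twt m (top l0) <= twt m T.
  have <- // : (0 <= (a l T *m mq) 0 0) = (twt m (top l0) <= twt m T).
    by rewrite -[RHS]subr_ge0 -(ler0z rat) -dotma pmulr_rge0.
  exact: mqP.
have QNa l (T : tidx (nus l)) : Q (- a l T) <-> twt m T <= twt m (top l0).
  have <- // : (0 <= (- a l T *m mq) 0 0) = (twt m T <= twt m (top l0)).
    rewrite -[RHS]subr_le0 -(lerz0 rat) -dotma pmulr_rle0 //.
    by rewrite mulNmx [(- _ : 'M_1) 0 0]mxE oppr_ge0.
  exact: mqP.
have mle l (T : tidx (nus l)) : graded T -> twt m T <= twt m (top l0).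
  move=> gT; apply/QNa; exists 0; apply: filterS (ex_le0 gT) => k.
  by rewrite dotN dota oppr0 oppr_ge0.
have delP l (T : tidx (nus l)) : graded T ->
    (twt m T == twt m (top l0)) = (del l T != 0).
  move=> gT; rewrite eq_le mle //=; apply/idP/idP.
    move/Qa => [M h]; apply/(expR_tends0P (lim l T gT)); exists M.
    by apply: filterS h => k; rewrite dota.
  move/(expR_tends0P (lim l T gT)) => [M h]; apply/Qa; exists M.
  by apply: filterS h => k; rewrite dota.
pose good (p : pairT) := graded (tagged p) && (twt m (tagged p) == twt m (top l0)).
(* Only the surviving weights have convergent exponents; zeroing the other columns makes [x k *m M]
   converge. *)
pose M : 'M[R]_(n, #|{: pairT}|) :=
  \matrix_(j, p) if good (enum_val p) then cf R (tagged (enum_val p)) j else 0.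
have xM (y : 'rV[R]_n) p : (y *m M) 0 p =
    if good (enum_val p) then tw y (tagged (enum_val p)) - tw y (top l0) else 0.
  rewrite mxE; case: ifP => gp; last by apply: big1 => j _; rewrite mxE gp mulr0.
  by rewrite /tw twt_cf; apply: eq_bigr => j _; rewrite mxE gp mulrC.
have [b bP] : {b : 'I_#|{: pairT}| -> R & forall p, tends U (fun k => (x k *m M) 0 p) (b p)}.
  apply: (@choice _ _ (fun p b => tends U (fun k => (x k *m M) 0 p) b)) => p.
  have [/andP [gT mT]|ngp] := boolP (good (enum_val p)); last first.
    by exists 0; apply: tends_ext (tends_cst 0) => k; rewrite xM (negbTE ngp).
  have : del _ (tagged (enum_val p)) != 0 by rewrite -delP.
  move/(expR_tends0P (lim _ _ gT)) => [B hB].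
  have [b hb] := tends_le0_bounded (ex_le0 gT) hB.
  by exists b; apply: tends_ext hb => k; rewrite xM /good gT mT.
(* The limit [b] stays in the row space of [M], so the pseudo-inverse gives an exact solution of
   [y *m M = b]. *)
pose y := \row_p b p *m pinvmx M.
have yM : y *m M = \row_p b p.
  by apply: (@tends_row_space _ U _ _ _ x) => j; rewrite mxE; exact: bP.
exists m, y; split=> //.
  move=> i j ij; rewrite -subr_ge0 -(ler0z rat).
  have : Q (e (i, j)).
    exists 0; apply: filterE => k; rewrite dote oppr0 subr_ge0.
    exact: x_dec.
  rewrite mqP // -(pmulr_rge0 _ c0) /e /= mulmxBl -!rowE !mxE mulrBr -!mE.
  by rewrite -rmorphB.
move=> l T gT; case: ifP => mT; last first.
  by apply/eqP/negPn; rewrite -delP // mT.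
pose p : 'I_#|{: pairT}| := enum_rank (Tagged (fun l => tidx (nus l)) T).
have gp : good (enum_val p) by rewrite /p enum_rankK /good /= gT mT.
have bE : b p = tw y T - tw y (top l0).
  have := congr1 (fun A : 'rV_ _ => A 0 p) yM.
  by rewrite xM gp mxE => <-; rewrite /p enum_rankK.
apply: (tends_uniq (lim l T gT)); rewrite -bE; apply: tends_expR.
by apply: tends_ext (bP p) => k; rewrite xM gp /p enum_rankK.
Qed.

End Limit.
End ClosureInImage.

(** * Compactness and identification of the limit *)

Section Closure.
Variables (R : realType) (n sigma : nat) (nus : 'I_sigma -> 'I_n -> nat).
Hypothesis nus_sig : forall l, isSignature (nus l).
Local Notation C := R[i].
Local Open Scope complex_scope.

(** The inverses of the outer factors are bounded too, so they converge along [F] as well, and the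
    relation with product 1 passes to the limit: the limit factors are invertible. *)
Lemma compact_factors (g : nat -> 'M[C]_n) : (forall k, g k \in unitmx) ->
  exists (U V : nat -> 'M[C]_n) (x : nat -> 'rV[R]_n) (Y W : 'M[C]_n) (F : set_system nat),
  [/\ UltraFilter F, (eventually `<=` F)%classic,
      forall k, g k = U k *m expdiag (x k) *m V k,
      forall k (i j : 'I_n), (i <= j)%N -> x k 0 j <= x k 0 i &
      [/\ Y \in unitmx, W \in unitmx,
          forall i j, tends F (fun k => U k i j) (Y i j) &
          forall i j, tends F (fun k => V k i j) (W i j)]].
Proof.
move=> gu; have [K piv] := pivoting R n.
have [f fP] : {f : nat -> ('M[C]_n * 'M[C]_n) * ('M[C]_n * 'M[C]_n) * 'rV[R]_n & forall k,
    [/\ g k = (f k).1.1.1 *m real_diag (f k).2 *m (f k).1.2.1,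
        (f k).1.1.1 *m (f k).1.1.2 = 1%:M, (f k).1.2.1 *m (f k).1.2.2 = 1%:M,
        [/\ bounded_mx K (f k).1.1.1, bounded_mx K (f k).1.1.2,
            bounded_mx K (f k).1.2.1 & bounded_mx K (f k).1.2.2] &
        (forall i, 0 < (f k).2 0 i) /\
        (forall i j : 'I_n, (i <= j)%N -> (f k).2 0 j <= (f k).2 0 i)]}.
  apply: (@choice _ _ (fun k f => [/\ g k = f.1.1.1 *m real_diag f.2 *m f.1.2.1,
        f.1.1.1 *m f.1.1.2 = 1%:M, f.1.2.1 *m f.1.2.2 = 1%:M,
        [/\ bounded_mx K f.1.1.1, bounded_mx K f.1.1.2,
            bounded_mx K f.1.2.1 & bounded_mx K f.1.2.2] &
        (forall i, 0 < f.2 0 i) /\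
        (forall i j : 'I_n, (i <= j)%N -> f.2 0 j <= f.2 0 i)])) => k.
  have [A [A' [B [B' [d [h1 h2 h3 h4 [h5 h6 _]]]]]]] := piv _ (gu k).
  by exists ((A, A'), (B, B'), d).
have [F [UF sF]] := ultraFilterLemma eventually_filter.
have lim (A : nat -> 'M[C]_n) : (forall k, bounded_mx K (A k)) ->
    exists A0 : 'M[C]_n, forall i j, tends F (fun k => A k i j) (A0 i j).
  move=> bA.
  have [a aP] : {a : 'I_n * 'I_n -> C & forall p, tends F (fun k => A k p.1 p.2) (a p)}.
    apply: (@choice _ _ (fun p z => tends F (fun k => A k p.1 p.2) z)) => p.
    apply: (@ultra_boundedC _ _ _ _ K%:R); apply: filterE => k.
    by rewrite rmorph_nat; exact: bA.
  exists (\matrix_(i, j) a (i, j)) => i j; rewrite mxE; exact: (aP (i, j)).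
have inv (A A' : nat -> 'M[C]_n) : (forall k, bounded_mx K (A k)) ->
    (forall k, bounded_mx K (A' k)) -> (forall k, A k *m A' k = 1%:M) ->
    exists2 A0 : 'M[C]_n, A0 \in unitmx & forall i j, tends F (fun k => A k i j) (A0 i j).
  move=> bA bA' AA'; have [A0 hA] := lim A bA; have [A0' hA'] := lim A' bA'.
  exists A0 => //; suff /mulmx1_unit [] : A0 *m A0' = 1%:M by [].
  apply/matrixP => i j; apply: (tends_uniq (tends_mulmx hA hA' i j)).
  by apply: tends_ext (tends_cst _) => k; rewrite AA'.
have [Y Yu hY] : exists2 A0 : 'M[C]_n, A0 \in unitmx &
    forall i j, tends F (fun k => (f k).1.1.1 i j) (A0 i j).
  by apply: (inv _ (fun k => (f k).1.1.2)) => k; have [? ? ? [? ? ? ?] ?] := fP k.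
have [W Wu hW] : exists2 A0 : 'M[C]_n, A0 \in unitmx &
    forall i j, tends F (fun k => (f k).1.2.1 i j) (A0 i j).
  by apply: (inv _ (fun k => (f k).1.2.2)) => k; have [? ? ? [? ? ? ?] ?] := fP k.
pose x k : 'rV[R]_n := \row_i ln ((f k).2 0 i).
exists (fun k => (f k).1.1.1), (fun k => (f k).1.2.1), x, Y, W, F; split=> //.
  move=> k; have [-> _ _ _ [d0 _]] := fP k; congr (_ *m _ *m _).
  rewrite /expdiag; congr real_diag; apply/rowP => i.
  by rewrite !mxE lnK // posrE.
move=> k i j ij; have [_ _ _ _ [d0 dd]] := fP k.
by rewrite !mxE ler_ln ?posrE // dd.
Qed.

Lemma closure_in_image (B : Zop R n sigma nus) :
  inClosure R n sigma nus B -> inImage R n sigma nus B.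
Proof.
case=> Bnz [c [g [gu glim]]].
have [U [V [x [Y [W [F [UF sF gE x_dec [Yu Wu hU hV]]]]]]]] := compact_factors gu.
have [z1 [z1Z [l1 [S1 BS1]]]] := Bnz.
pose top l : tidx (nus l) := top_idx (nus l).
pose tw (y : 'rV[R]_n) l (T : tidx (nus l)) : R := twt (fun j => y 0 j) T.
have [l0 l0_max] := ultra_argmax UF l1 (fun l k => tw (x k) l (top l)).
pose e l (T : tidx (nus l)) k : R := tw (x k) l T - tw (x k) l0 (top l0).
have [del delP] : {del : pairT nus -> R & forall p : pairT nus, graded (tagged p) ->
    tends F (fun k => expR (e (tag p) (tagged p) k)) (del p)}.
  apply: (@choice (pairT nus) R (fun (p : pairT nus) d => graded (tagged p) ->
    tends F (fun k => expR (e (tag p) (tagged p) k)) d)) => p.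
  have [gT|//] := boolP (graded (tagged p)); last by exists 0.
  have [d hd] : exists d, tends F (fun k => expR (e (tag p) (tagged p) k)) d.
    apply: (@ultra_bounded _ _ _ _ 1).
    apply: filterS (ex_le0 UF x_dec l0_max gT) => k h.
    by rewrite ger0_norm ?expR_ge0 // -(expR0 R) ler_expR.
  by exists d.
pose dl l (T : tidx (nus l)) : R := del (Tagged (fun l => tidx (nus l)) T).
have dlP l (T : tidx (nus l)) : graded T -> tends F (fun k => expR (e l T k)) (dl l T).
  by move=> gT; exact: (delP (Tagged (fun l => tidx (nus l)) T)).
pose D l (T : tidx (nus l)) : C := if graded T then (dl l T)%:C else 0.
pose Dk k l (T : tidx (nus l)) : C := if graded T then (expR (e l T k))%:C else 0.
pose N (z : Zvec R n sigma nus) l S := tdiag Y W (D l) (z l) S.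
pose Nk k (z : Zvec R n sigma nus) l S := tdiag (U k) (V k) (Dk k l) (z l) S.
have Nlim z l S : tends F (fun k => Nk k z l S) (N z l S).
  apply: tends_tdiag => // T; rewrite /Dk /D; case: ifP => gT; last exact: tends_cst.
  by apply: tends_real; exact: dlP.
(* Dividing by the dominant exponential makes [Nk] converge; nothing is known yet about the limit of
   the remaining scalar [cc]. *)
pose cc k : C := c k * (expR (tw (x k) l0 (top l0)))%:C.
have Blim z l S : inZ R n sigma nus z -> tends F (fun k => cc k * Nk k z l S) (B z l S).
  move=> zZ; have /cvgC_tends /(tends_sub sF) := glim z zZ l S.
  apply: tends_ext => k; rewrite /cc -mulrA; congr (_ * _).
  rewrite gE zetaG_expdiag /Nk -tdiagZ; congr (_ S).
  apply: eq_tdiag => [|T gT]; first exact: inH_graded (zZ l).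
  rewrite /Dk gT -rmorphM /= -expRD; congr (expR _)%:C.
  by rewrite /e addrC subrK.
(* Test vector that [W] sends to [Xi] in the dominant summand, so that [N] sends it to the nonzero
   vector [rT (lam_cha Y) Xi]. *)
pose z0 : Zvec R n sigma nus := fun l S =>
  if l == l0 then rT (lam_cha (invmx W)) (@Xi R n (nus l)) S else 0.
have z0Z : inZ R n sigma nus z0.
  move=> l; rewrite /z0; case: eqP => [->|_]; last exact: inH_0.
  by apply: inH_rT; rewrite unitmx_inv.
have dl0 : dl l0 (top l0) = 1.
  apply: (tends_uniq (dlP l0 (top l0) (graded_top _))).
  by apply: tends_ext (tends_cst 1) => k; rewrite /e subrr expR0.
have rT1 l (v : tvec R (nus l)) : rT (dlop (fun=> 1)) v = v.
  by apply/funext => S; rewrite rT_dlop big1 ?mul1r.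
have Nz0 S : N z0 l0 S = rT (lam_cha Y) (@Xi R n (nus l0)) S.
  rewrite /N /tdiag /z0 eqxx /= -rT_mul lam_chaVr // rT1.
  apply: eq_bigr => T _; rewrite XiE; case: eqP => [->|_]; last by rewrite !mulr0.
  by rewrite /D graded_top dl0 mulr1.
have [S0 S0nz] : exists S, N z0 l0 S != 0.
  apply: contrapT => none.
  have E : rT (lam_cha Y) (@Xi R n (nus l0)) = fun=> 0.
    apply/funext => S; rewrite -Nz0; apply/eqP/negPn/negP => nz.
    by apply: none; exists S.
  have := congr1 (fun v => rT (lam_cha (invmx Y)) v (top l0)) E.
  rewrite /= -rT_mul lam_chaVl // rT1 XiE eqxx /rT big1; last by move=> T _; rewrite mulr0.
  by move/eqP; rewrite oner_eq0.
set n0 := N z0 l0 S0 in S0nz.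
(* Cross-multiplication cancels [cc]: both sides are limits of
   [cc k * Nk k z l S * Nk k z0 l0 S0]. *)
have key z l S : inZ R n sigma nus z -> B z l S * n0 = B z0 l0 S0 * N z l S.
  move=> zZ; apply: (tends_uniq (tendsM (Blim z l S zZ) (Nlim z0 l0 S0))).
  apply: tends_ext (tendsM (Blim z0 l0 S0 z0Z) (Nlim z l S)) => k.
  by rewrite mulrAC.
have b0 : B z0 l0 S0 != 0.
  apply: contra BS1 => /eqP b0; have := key z1 l1 S1 z1Z.
  by rewrite b0 mul0r => /eqP; rewrite mulf_eq0 (negbTE S0nz) orbF.
pose r := n0 / B z0 l0 S0; have r0 : r != 0 by rewrite mulf_neq0 ?invr_eq0.
have NB z l S : inZ R n sigma nus z -> N z l S = r * B z l S.
  by move=> zZ; rewrite /r mulrAC [n0 * _]mulrC key // mulrAC divff ?mul1r.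
have [m [y [mdec mgcd mle dlE]]] := tropical_limit nus_sig UF x_dec l0_max dlP.
pose w0 := (expR (tw y l0 (top l0)))%:C : C.
have w00 : w0 != 0 by rewrite fmorph_eq0 gt_eqF ?expR_gt0.
have DE l (T : tidx (nus l)) : graded T -> w0 * D l T =
    if twt m T == twt m (top l0) then (expR (tw y l T))%:C else 0.
  move=> gT; rewrite /D gT dlE //; case: ifP => _; last by rewrite mulr0.
  by rewrite /w0 -rmorphM /= -expRD addrC subrK.
have expu : expdiag y \in unitmx.
  rewrite unitmxE det_diag unitfE; apply/prodf_neq0 => i _.
  by rewrite !mxE fmorph_eq0 gt_eqF ?expR_gt0.
(* If [m = 0], every graded weight survives and the limit is the class of the invertible matrix
   [Y exp(y) W]. *)
case: mgcd => [m0|mgcd].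
  left; exists (Y *m expdiag y *m W); split; first by rewrite !unitmx_mul Yu expu Wu.
  split=> //; exists (w0 * r); split=> [|z zZ l S]; first exact: mulf_neq0.
  rewrite -mulrA -NB // zetaG_expdiag /N -tdiagZ; congr (_ S).
  apply: eq_tdiag => [|T gT]; first exact: inH_graded (zZ l).
  have tw0 l' (T' : tidx (nus l')) : twt m T' = 0.
    by apply: big1 => i _; apply: big1 => j _; rewrite m0.
  by rewrite DE // !tw0 eqxx.
have t0 : (0 < tau n m)%N.
  have n_gt0 : (0 < n)%N.
    rewrite lt0n; apply/eqP => n_eq0; move: mgcd; rewrite big1 // => i _.
    by have := ltn_ord i; rewrite [X in (_ < X)%N]n_eq0.
  exact: leq_ltn_trans (blk_lt m (Ordinal n_gt0)).
(* The bounded part [exp(y)] is absorbed into the target basis, while the projection onto the top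
   face of [m] becomes [L(P)]. *)
right; pose X := invmx W; pose Y' := Y *m expdiag y.
have Xu : X \in unitmx by rewrite unitmx_inv.
have Y'u : Y' \in unitmx by rewrite unitmx_mul Yu expu.
have [P [L [PO LN LL]]] := @hinge_exists R n m mdec X Y' t0 Xu Y'u.
exists m, P, L, (conj_lop X Y' (etop R m)), (vl n sigma nus m l0).
split=> //; split=> //.
  by split; [exists l0 | move=> l; rewrite !vl_top //; exact/mle/graded_top].
split=> //; exists (w0 * r); split=> [|z zZ l S]; first exact: mulf_neq0.
rewrite -mulrA -NB // /N -tdiagZ.
have zg := inH_graded (zZ l).
rewrite /zetaSpike /zetaOp; have [/eqP vlv|vlv] := boolP (vl n sigma nus m l == _).
  have -> : conj_lop X Y' (etop R m) = lop_mul (lam_cha Y) (lop_mul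
     (dlop (fun S => (expR (wt (fun j => y 0 j) S))%:C * etop R m S)) (lam_cha W)).
    rewrite /conj_lop /Y' lam_chaM lam_expdiag -lop_mulA invmxK; congr lop_mul.
    by apply/lopEqP => P' Q'; rewrite !dlop_mull mulrA.
  rewrite rT_tdiag; congr (_ S); apply: eq_tdiag => // T gT.
  rewrite DE // big_split prod_expdiag /= -/(tw y l T).
  rewrite !vl_top // in vlv; rewrite -vlv (twt_top_le mdec gT).2.
  have [/forallP h|/forallPn [i h]] := boolP [forall i, wt m (T i) == wt m (firsts n #|T i|)].
    by rewrite [X in _ * X]big1 ?mulr1 // => i _; rewrite /etop h.
  by rewrite [X in _ * X](bigD1 i) //= /etop (negbTE h) mul0r mulr0.
rewrite (@eq_tdiag _ _ _ _ _ _ (fun=> 0)) //; last first.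
  move=> T gT; rewrite DE // lt_eqF //.
  apply: le_lt_trans (twt_top_le mdec gT).1 _.
  rewrite !vl_top // in vlv; rewrite lt_neqAle vlv; exact/mle/graded_top.
by rewrite /tdiag big1 // => T _; rewrite mul0r mulr0.
Qed.

End Closure.

Theorem theorem3p5 (R : realType) (n sigma : nat)
    (nus : 'I_sigma -> 'I_n -> nat)
    (Hnus : forall l : 'I_sigma, isSignature (nus l))
    (B : Zop R n sigma nus) :
  inImage R n sigma nus B <-> inClosure R n sigma nus B.
Proof. by split; [exact: image_in_closure | exact: closure_in_image]. Qed.
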